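(* Let $\mathfrak{g}=\mathfrak{sl}_2(\mathbb{C})\ltimes V_2$ and let $k\ge 0$. Then $$H^k(\mathfrak{g},\mathfrak{g})\cong\begin{cases}\mathbb{C}, & \text{if } k=1,2,4,5,\\ 0, & \text{otherwise.}\end{cases}$$
   Context: $V_m$ denotes the irreducible $\mathfrak{sl}_2(\mathbb{C})$-module of dimension $m+1$. The semidirect product $\mathfrak{sl}_2(\mathbb{C})\ltimes V_m$ is the vector space $\mathfrak{sl}_2(\mathbb{C})\oplus V_m$ with Lie bracket $[(X,v),(Y,u)]=([X,Y],Xu-Yv)$. $H^k(\mathfrak{g},\mathfrak{g})$ denotes the $k$-th Lie algebra (Chevalley–Eilenberg) cohomology of $\mathfrak{g}$ with coefficients in the adjoint module. *)

(* Defs.v *)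
From HB Require Import structures.
From mathcomp Require Import all_boot all_order all_algebra.
From mathcomp Require Import ssrAC ring_quotient generic_quotient.
From mathcomp Require Import boolp functions reals complex.

Set Implicit Arguments.
Unset Strict Implicit.
Unset Printing Implicit Defensive.

Import GRing.Theory.
Local Open Scope ring_scope.
Local Open Scope quotient_scope.

Fact jacobi_sum (V : zmodType) (a b c d e f : V) :
  (a - b - (c - d)) + (c - e - (f - b)) + (f - d - (a - e)) = 0.
Proof.
rewrite !opprB !addrA.
rewrite [LHS](ACl ((1*12)*(2*7)*(3*10)*(4*5)*(6*11)*(8*9)))%AC /=.
by rewrite !subrr !addNr !addr0.
Qed.

HB.mixin Record Lmodule_isLieAlgebra (F : fieldType) L of GRing.Lmodule F L := {
  lie : L -> L -> L;
  lie_linear_l : forall (a : F) (x y z : L),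
    lie (a *: x + y) z = a *: lie x z + lie y z;
  lie_linear_r : forall (a : F) (x y z : L),
    lie z (a *: x + y) = a *: lie z x + lie z y;
  liexx : forall x : L, lie x x = 0;
  lie_jacobi : forall x y z : L,
    lie x (lie y z) + lie y (lie z x) + lie z (lie x y) = 0 }.

#[short(type="lieAlgType")]
HB.structure Definition LieAlgebra (F : fieldType) :=
  { L of GRing.Lmodule F L & Lmodule_isLieAlgebra F L }.

HB.mixin Record Lmodule_isLieModule (F : fieldType) (L : lieAlgType F) M
    of GRing.Lmodule F M := {
  act : L -> M -> M;
  act_linear_l : forall (a : F) (x y : L) (v : M),
    act (a *: x + y) v = a *: act x v + act y v;
  act_linear_r : forall (a : F) (x : L) (u v : M),
    act x (a *: u + v) = a *: act x u + act x v;
  act_lie : forall (x y : L) (v : M),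
    act (lie x y) v = act x (act y v) - act y (act x v) }.

#[short(type="lieModType")]
HB.structure Definition LieModule (F : fieldType) (L : lieAlgType F) :=
  { M of GRing.Lmodule F M & Lmodule_isLieModule F L M }.

#[short(type="lieVectType")]
HB.structure Definition LieVector (F : fieldType) (L : lieAlgType F) :=
  { M of Vector F M & Lmodule_isLieModule F L M }.

Definition irreducible_module (F : fieldType) (L : lieAlgType F)
    (V : lieVectType L) : Prop :=
  \dim {:V} != 0%N /\
  forall U : {vspace V},
    (forall (x : L) (v : V), v \in U -> act x v \in U) ->
    U = 0%VS \/ U = fullv.

Section LieBasics.
Variables (F : fieldType) (L : lieAlgType F).
Implicit Types x y z : L.

Lemma lieDl x y z : lie (x + y) z = lie x z + lie y z.
Proof. by rewrite -{1}[x]scale1r lie_linear_l scale1r. Qed.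

Lemma lieDr x y z : lie z (x + y) = lie z x + lie z y.
Proof. by rewrite -{1}[x]scale1r lie_linear_r scale1r. Qed.

Lemma lie_anticomm x y : lie y x = - lie x y.
Proof.
apply/eqP; rewrite -addr_eq0; apply/eqP.
by have := liexx (x + y); rewrite lieDl !lieDr !liexx add0r addr0 addrC.
Qed.

Lemma lieNr x y : lie y (- x) = - lie y x.
Proof.
have := lie_linear_r (-1) x 0 y; rewrite scaleN1r addr0 => ->.
have -> : lie y 0 = 0.
  by apply: (addrI (lie y 0)); rewrite -lieDr !addr0.
by rewrite addr0 scaleN1r.
Qed.

Variable M : lieModType L.
Implicit Types u v : M.

Lemma actDr x u v : act x (u + v) = act x u + act x v.
Proof. by rewrite -{1}[u]scale1r act_linear_r scale1r. Qed.

Lemma act0r x : act x (0 : M) = 0.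
Proof. by apply: (addrI (act x 0)); rewrite -actDr !addr0. Qed.

Lemma actZr (a : F) x v : act x (a *: v) = a *: act x v.
Proof. by rewrite -[a *: v]addr0 act_linear_r act0r addr0. Qed.

Lemma actNr x v : act x (- v) = - act x v.
Proof. by rewrite -scaleN1r actZr scaleN1r. Qed.

End LieBasics.

Definition adjoint (F : fieldType) (L : lieAlgType F) : Type := L.

Section Adjoint.
Variables (F : fieldType) (L : lieAlgType F).

HB.instance Definition _ := GRing.Lmodule.on (adjoint L).

Fact ad_lie (x y : L) (z : adjoint L) :
  lie (lie x y) z = lie x (lie y z : L) - lie y (lie x z : L) :> adjoint L.
Proof.
have J := lie_jacobi x y (z : L).
move: J; rewrite [lie z (lie x y)]lie_anticomm.
by rewrite [lie z x]lie_anticomm lieNr => /eqP; rewrite subr_eq0 => /eqP <-.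
Qed.

HB.instance Definition _ := Lmodule_isLieModule.Build F L (adjoint L)
  (fun a x y v => lie_linear_l a x y v)
  (fun a x u v => lie_linear_r a u v x) ad_lie.

End Adjoint.

Definition traceless (F : fieldType) (n : nat) (A : 'M[F]_n) : bool :=
  \tr A == 0.

Fact traceless_submod (F : fieldType) (n : nat) :
  submod_closed (@traceless F n).
Proof.
split=> [|a A B]; first by rewrite /in_mem /= /traceless linear0.
rewrite /in_mem /= /traceless => /eqP trA /eqP trB.
by rewrite linearP /= trA trB mulr0 addr0.
Qed.

HB.instance Definition _ (F : fieldType) (n : nat) :=
  GRing.isSubmodClosed.Build F 'M[F]_n (@traceless F n)
    (traceless_submod F n).

Record sl (F : fieldType) (n : nat) : Type := SL {
  slval :> 'M[F]_n; _ : traceless slval }.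

Section SpecialLinear.
Variables (F : fieldType) (n : nat).

HB.instance Definition _ := [isSub for @slval F n].
HB.instance Definition _ := [Choice of sl F n by <:].
HB.instance Definition _ := [SubChoice_isSubLmodule of sl F n by <:].

Fact traceless_commutator (A B : 'M[F]_n) : traceless (A *m B - B *m A).
Proof. by rewrite /traceless linearB /= mxtrace_mulC subrr. Qed.

Definition sl_lie (A B : sl F n) : sl F n := SL (traceless_commutator A B).

Fact sl_lie_linear_l (a : F) (x y z : sl F n) :
  sl_lie (a *: x + y) z = a *: sl_lie x z + sl_lie y z.
Proof.
apply: val_inj; rewrite /= mulmxDl mulmxDr -scalemxAl -scalemxAr.
by rewrite scalerBr opprD addrACA.
Qed.

Fact sl_lie_linear_r (a : F) (x y z : sl F n) :
  sl_lie z (a *: x + y) = a *: sl_lie z x + sl_lie z y.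
Proof.
apply: val_inj; rewrite /= mulmxDl mulmxDr -scalemxAl -scalemxAr.
by rewrite scalerBr opprD addrACA.
Qed.

Fact sl_liexx (x : sl F n) : sl_lie x x = 0.
Proof. by apply: val_inj; rewrite /= subrr. Qed.

Fact sl_lie_jacobi (x y z : sl F n) :
  sl_lie x (sl_lie y z) + sl_lie y (sl_lie z x) + sl_lie z (sl_lie x y) = 0.
Proof.
apply: val_inj; rewrite /= !mulmxBl !mulmxBr !mulmxA.
exact: jacobi_sum.
Qed.

HB.instance Definition _ := Lmodule_isLieAlgebra.Build F (sl F n)
  sl_lie_linear_l sl_lie_linear_r sl_liexx sl_lie_jacobi.

End SpecialLinear.

Definition semidirect (F : fieldType) (L : lieAlgType F) (M : lieModType L) :
  Type := (L * M)%type.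

Section Semidirect.
Variables (F : fieldType) (L : lieAlgType F) (M : lieModType L).
Local Notation g := (semidirect M).

HB.instance Definition _ := GRing.Lmodule.copy g (L * M)%type.

Definition semidirect_lie (p q : g) : g :=
  (lie p.1 q.1, act p.1 q.2 - act q.1 p.2).

Fact semidirect_lie_linear_l (a : F) (x y z : g) :
  semidirect_lie (a *: x + y) z
  = a *: semidirect_lie x z + semidirect_lie y z.
Proof.
congr pair; rewrite /= ?lie_linear_l //.
by rewrite act_linear_l act_linear_r scalerBr opprD addrACA.
Qed.

Fact semidirect_lie_linear_r (a : F) (x y z : g) :
  semidirect_lie z (a *: x + y)
  = a *: semidirect_lie z x + semidirect_lie z y.
Proof.
congr pair; rewrite /= ?lie_linear_r //.
by rewrite act_linear_l act_linear_r scalerBr opprD addrACA.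
Qed.

Fact semidirect_liexx (x : g) : semidirect_lie x x = 0.
Proof. by congr pair; rewrite /= ?liexx ?subrr. Qed.

Fact semidirect_lie_jacobi (x y z : g) :
  semidirect_lie x (semidirect_lie y z) + semidirect_lie y (semidirect_lie z x)
  + semidirect_lie z (semidirect_lie x y) = 0.
Proof.
congr pair; rewrite /= ?lie_jacobi //.
rewrite !act_lie !actDr !actNr.
exact: jacobi_sum.
Qed.

HB.instance Definition _ := Lmodule_isLieAlgebra.Build F g
  semidirect_lie_linear_l semidirect_lie_linear_r
  semidirect_liexx semidirect_lie_jacobi.

End Semidirect.

(* The copy of S below carries the closure under opposites that MathComp does
   not infer from closure under scaling; Quotient.quot requires it. *)
Definition lquot_pred (F : fieldType) (V : lmodType F)
  (S : submodClosed V) : V -> bool := fun v => v \in S.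

Section LquotPred.
Variables (F : fieldType) (V : lmodType F) (S : submodClosed V).

Fact lquot_pred_zmod : zmod_closed (lquot_pred S).
Proof.
split=> [|x y Sx Sy]; first exact: (rpred0 S).
apply: (rpredD (Sx : x \in S)).
by rewrite -scaleN1r; apply: (rpredZ (-1) (Sy : y \in S)).
Qed.

HB.instance Definition _ :=
  GRing.isZmodClosed.Build V (lquot_pred S) lquot_pred_zmod.

End LquotPred.

Definition lquot (F : fieldType) (V : lmodType F) (S : submodClosed V) :
  Type := Quotient.quot (GRing.ZmodClosed.clone V (lquot_pred S) _).

Section Lquot.
Variables (F : fieldType) (V : lmodType F) (S : submodClosed V).
Local Notation Q := (lquot S).

HB.instance Definition _ := GRing.Zmodule.on Q.
HB.instance Definition _ := EqQuotient.on Q.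

Definition lquot_pi (v : V) : Q := \pi_Q v.

Fact lquot_pi_repr (x : Q) : lquot_pi (repr x) = x.
Proof. exact: reprK. Qed.

Fact lquot_piD (u v : V) : lquot_pi (u + v) = lquot_pi u + lquot_pi v.
Proof. exact: Quotient.pi_add. Qed.

Definition lquot_scale (a : F) (x : Q) : Q := lquot_pi (a *: repr x).

Fact lquot_pi_scale (a : F) (v : V) :
  lquot_scale a (lquot_pi v) = lquot_pi (a *: v).
Proof.
apply/eqP; rewrite /lquot_scale -Quotient.idealrBE -scalerBr.
apply: (rpredZ a (_ : _ \in S)).
by rewrite -[_ \in S]/(_ \in lquot_pred S) Quotient.idealrBE reprK.
Qed.

Fact lquot_scaleA a b (x : Q) :
  lquot_scale a (lquot_scale b x) = lquot_scale (a * b) x.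
Proof. by rewrite -[x]lquot_pi_repr !lquot_pi_scale scalerA. Qed.

Fact lquot_scale1 : left_id 1 lquot_scale.
Proof. by move=> x; rewrite -[x]lquot_pi_repr lquot_pi_scale scale1r. Qed.

Fact lquot_scaleDr : right_distributive lquot_scale +%R.
Proof.
move=> a x y; rewrite -[x]lquot_pi_repr -[y]lquot_pi_repr.
by rewrite -lquot_piD !lquot_pi_scale -lquot_piD scalerDr.
Qed.

Fact lquot_scaleDl (x : Q) : {morph lquot_scale^~ x : a b / a + b}.
Proof.
move=> a b; rewrite -[x]lquot_pi_repr !lquot_pi_scale -lquot_piD.
by rewrite scalerDl.
Qed.

HB.instance Definition _ := GRing.Zmodule_isLmodule.Build F Q
  lquot_scaleA lquot_scale1 lquot_scaleDr lquot_scaleDl.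

Fact lquot_pi_linear : linear lquot_pi.
Proof. by move=> a u v; rewrite lquot_piD -lquot_pi_scale. Qed.

HB.instance Definition _ :=
  GRing.isLinear.Build F V Q *:%R lquot_pi lquot_pi_linear.

Lemma lquot_pi_eq0 (v : V) : (lquot_pi v == 0) = (v \in S).
Proof.
have -> : 0 = lquot_pi 0 by rewrite linear0.
by rewrite -Quotient.idealrBE subr0.
Qed.

End Lquot.

Section Cohomology.
Variables (F : fieldType) (L : lieAlgType F) (M : lieModType L).

(* Points of L^k, and arbitrary functions L^k -> M; the latter form a vector
   space pointwise. *)
Definition args (k : nat) : Type := {ffun 'I_k -> L}.
Definition fcochain (k : nat) : Type := args k -> M.

HB.instance Definition _ k := GRing.Lmodule.on (fcochain k).

Definition set_arg k (x : args k) (i : 'I_k) (v : L) : args k :=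
  [ffun l => if l == i then v else x l].

Definition multilinear k (f : fcochain k) : Prop :=
  forall (x : args k) (i : 'I_k) (a : F) (u v : L),
    f (set_arg x i (a *: u + v))
    = a *: f (set_arg x i u) + f (set_arg x i v).

Definition alternating k (f : fcochain k) : Prop :=
  forall (x : args k) (i j : 'I_k), i != j -> x i = x j -> f x = 0.

Definition cochain k (f : fcochain k) : Prop := multilinear f /\ alternating f.

(* (x_0, ..., ^x_i, ..., x_k) *)
Definition omit1 k (x : args k.+1) (i : 'I_k.+1) : args k :=
  [ffun l => x (lift i l)].

(* ([x_i, x_j], x_0, ..., ^x_i, ..., ^x_j, ..., x_k); for i != j the list has
   exactly k entries, so the default value of nth is never used. *)
Definition lie_omit2 k (x : args k.+1) (i j : 'I_k.+1) : args k :=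
  [ffun l : 'I_k =>
    nth 0 (lie (x i) (x j)
           :: [seq x m | m <- enum 'I_k.+1 & (m != i) && (m != j)]) l].

Definition ce_d k (f : fcochain k) : fcochain k.+1 := fun x =>
  \sum_(i < k.+1) (-1) ^+ i *: act (x i) (f (omit1 x i))
  + \sum_(i < k.+1) \sum_(j < k.+1 | (i < j)%N)
      (-1) ^+ (i + j) *: f (lie_omit2 x i j).

Definition cocycle k (f : fcochain k) : bool := `[< cochain f /\ ce_d f = 0 >].

Definition coboundary k : fcochain k -> Prop :=
  match k with
  | 0 => fun f => f = 0
  | k'.+1 => fun f => exists2 c : fcochain k', cochain c & f = ce_d c
  end.

Lemma cochain0 k : cochain (0 : fcochain k).
Proof.
by split=> [x i a u v|//]; rewrite -[0 _]/(0 : M) scaler0 addr0.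
Qed.

Lemma cochainP k (a : F) (f g : fcochain k) :
  cochain f -> cochain g -> cochain (a *: f + g).
Proof.
move=> [fl fa] [gl ga]; split=> [x i b u v|x i j ij xij].
  rewrite -![(a *: f + g) _]/(a *: f _ + g _) fl gl !scalerDr addrACA.
  by rewrite !scalerA [a * b]mulrC.
by rewrite -[(a *: f + g) _]/(a *: f _ + g _) (fa _ _ _ ij) // (ga _ _ _ ij) //
  scaler0 addr0.
Qed.

Lemma ce_d_linear k (a : F) (f g : fcochain k) :
  ce_d (a *: f + g) = a *: ce_d f + ce_d g.
Proof.
apply: funext => x; rewrite -[RHS]/(a *: ce_d f x + ce_d g x) /ce_d.
rewrite scalerDr addrACA; congr (_ + _); rewrite scaler_sumr -big_split /=.
  apply: eq_bigr => i _; rewrite -[(a *: f + g) _]/(a *: f _ + g _).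
  by rewrite act_linear_r scalerDr !scalerA mulrC.
apply: eq_bigr => i _; rewrite scaler_sumr -big_split /=.
apply: eq_bigr => j _; rewrite -[(a *: f + g) _]/(a *: f _ + g _).
by rewrite scalerDr !scalerA mulrC.
Qed.

Lemma ce_d0 k : ce_d (0 : fcochain k) = 0.
Proof.
have := ce_d_linear (-1) (0 : fcochain k) 0.
by rewrite scaler0 addr0 scaleN1r addNr.
Qed.

Fact cocycle_submod k : submod_closed (@cocycle k).
Proof.
split=> [|a f g /asboolP[fc df] /asboolP[gc dg]]; apply/asboolP.
  by split; [exact: cochain0 | exact: ce_d0].
by split; [exact: cochainP | rewrite ce_d_linear df dg scaler0 addr0].
Qed.

HB.instance Definition _ k :=
  GRing.isSubmodClosed.Build F (fcochain k) (@cocycle k) (cocycle_submod k).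

Record cocycles (k : nat) : Type := Cocycle {
  cocycle_val :> fcochain k; _ : cocycle cocycle_val }.

HB.instance Definition _ k := [isSub for @cocycle_val k].
HB.instance Definition _ k := [Choice of cocycles k by <:].
HB.instance Definition _ k := [SubChoice_isSubLmodule of cocycles k by <:].

(* Every coboundary is a cocycle since ce_d squares to zero, so this predicate
   cuts out all of B^k inside Z^k. *)
Definition coboundaries k (z : cocycles k) : bool := `[< coboundary (val z) >].

Fact coboundaries_submod k : submod_closed (@coboundaries k).
Proof.
split=> [|a f g /asboolP fb /asboolP gb]; apply/asboolP.
  by case: k => [//|k]; exists 0; [exact: cochain0 | rewrite ce_d0].
rewrite linearP; case: k f g fb gb => [|k] f g /=.
  by move=> -> ->; rewrite scaler0 addr0.
move=> [b bc ->] [c cc ->].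
by exists (a *: b + c); [exact: cochainP | rewrite ce_d_linear].
Qed.

HB.instance Definition _ k :=
  GRing.isSubmodClosed.Build F (cocycles k) (@coboundaries k)
    (coboundaries_submod k).

Definition cohomology (k : nat) : lmodType F :=
  lquot (GRing.SubmodClosed.clone F (cocycles k) (@coboundaries k) _).

End Cohomology.

Definition lmod_iso (F : fieldType) (U V : lmodType F) : Prop :=
  exists phi : {linear U -> V}, bijective phi.

(* Main.v *)
From HB Require Import structures.
Require Import Defs.
From mathcomp Require Import all_boot all_order all_algebra.
From mathcomp Require Import ssrAC ring.
From mathcomp Require Import boolp functions reals complex.

(** The algebra sl2 |>< V2 is the Takiff algebra sl2 (x) C[t]/(t^2): an
    irreducible module of dimension 3 is isomorphic to the adjoint one, because
    applying f repeatedly to a vector of highest weight mu produces a basis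
    u0, u1, u2 with f u2 = 0, and 0 = e (f u2) = 3 (mu - 2) u2 forces mu = 2
    ([weight_basis], [adjoint_basis]).  So the algebra has a basis
    e, h, f, E, H, F, numbered 0, ..., 5, with integral structure constants
    ([takiff_structured]), where E, H, F are the multiples of e, h, f by t.

    By the Hochschild-Serre factorization, the cohomology is the tensor product
    of H^*(sl2), which lives in degrees 0 and 3, with the cohomology of the
    complex of invariants in Hom(Lambda V2, g).  The classes of the latter are
    spanned by the inclusion of V2, in degree 1, and by the map
    (x t, y t) |-> [x, y], in degree 2: whence the degrees 1, 2, 4, 5.

    The proof does not go through that factorization.  It works with the finite
    complex itself, of dimension 6 * 'C(6, k) in degree k, and exhibits integral
    matrices h, an integral cocycle z and an integral functional ell with
      d h + h d = 12 - z ell,    ell d = 0,    ell z = 12,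
    where z and ell are 0 unless k is 1, 2, 4 or 5.  A cocycle that ell kills
    is then 1/12 times the coboundary of its image by h, so that ell induces an
    isomorphism from the cohomology to the base field, or the cohomology is 0
    ([cohomology_eq0], [cohomology_line]).  The three identities concern
    matrices of integers and hold by computation ([takiff_homotopy],
    [takiff_class]).

    Most of the text relates cochains to these matrices.  The differential obeys
    Cartan's recursion
      (d f)(x, y) = (L_x f)(y) - d(f(x, -))(y),
    which is easier to use than the defining double sum: by induction it shows
    that d preserves alternating maps ([lcochain_cartan_d]) and gives the
    rows of the matrix of d ([evalf_d_form]).  An alternating map is determined
    by its values on increasing lists of basis vectors ([lcochain_eq0]), and
    minors of coordinate matrices give a cochain with any prescribed values
    ([wedge_coord]). *)

Set Implicit Arguments.
Unset Strict Implicit.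
Unset Printing Implicit Defensive.

Import GRing.Theory Num.Theory VectorInternalTheory.
Local Open Scope ring_scope.

(** * Alternating multilinear maps on lists *)

Section LieModuleFacts.
Variables (F : fieldType) (L : lieAlgType F) (M : lieModType L).
Implicit Types (x : L) (v : M).

Lemma lie0r x : lie x (0 : L) = 0.
Proof. by apply: (addrI (lie x 0)); rewrite -lieDr !addr0. Qed.

Lemma lie0l x : lie (0 : L) x = 0.
Proof. by rewrite lie_anticomm lie0r oppr0. Qed.

Lemma act0l v : act (0 : L) v = 0.
Proof.
apply: (addrI (act (0 : L) v)).
by rewrite -{1}[act _ v]scale1r -act_linear_l scaler0 !addr0.
Qed.

Lemma actZl (a : F) x v : act (a *: x) v = a *: act x v.
Proof. by rewrite -[a *: x]addr0 act_linear_l act0l addr0. Qed.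

End LieModuleFacts.

Section ListCochains.
Variables (F : fieldType) (L : lieAlgType F) (M : lieModType L).
Implicit Types (f : seq L -> M) (x u v : L) (s y : seq L).

(** Alternation is only required for equal neighbours: this is what survives
    an induction on the list, and with multilinearity it implies the rest. *)
Record lcochain (k : nat) (f : seq L -> M) : Prop := LCochain {
  lcochain_linear : forall s1 s2 (a : F) u v, (size s1 + size s2).+1 = k ->
    f (s1 ++ (a *: u + v) :: s2) = a *: f (s1 ++ u :: s2) + f (s1 ++ v :: s2);
  lcochain_alt : forall s1 s2 u, (size s1 + size s2).+2 = k ->
    f (s1 ++ u :: u :: s2) = 0 }.

Lemma lcochain_cons k f x : lcochain k.+1 f -> lcochain k (fun y => f (x :: y)).
Proof.
by case=> fl fa; split=> [s1 s2 a u v sz|s1 s2 u sz];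
  [apply: (fl (x :: s1)) | apply: (fa (x :: s1))] => /=; rewrite -sz.
Qed.

Lemma lcochain_add k f s1 s2 u v : lcochain k f -> (size s1 + size s2).+1 = k ->
  f (s1 ++ (u + v) :: s2) = f (s1 ++ u :: s2) + f (s1 ++ v :: s2).
Proof.
by move=> fc sz; rewrite -{1}[u]scale1r (lcochain_linear fc) ?scale1r.
Qed.

Lemma lcochain_swap k f s1 s2 u v : lcochain k f ->
    (size s1 + size s2).+2 = k ->
  f (s1 ++ u :: v :: s2) = - f (s1 ++ v :: u :: s2).
Proof.
move=> fc sz; apply/eqP; rewrite -addr_eq0; apply/eqP.
have sz1 : (size s1 + size ((u + v) :: s2)).+1 = k by rewrite addnS.
have szr w : (size (rcons s1 w) + size s2).+1 = k by rewrite size_rcons addSn.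
have := lcochain_alt fc (u + v) sz.
rewrite (lcochain_add _ _ fc sz1) -(cat_rcons u) -(cat_rcons v).
rewrite !(lcochain_add _ _ fc (szr _)) !cat_rcons.
by rewrite !(lcochain_alt fc _ sz) add0r addr0.
Qed.

Lemma lcochain_zero k f s1 s2 : lcochain k f -> (size s1 + size s2).+1 = k ->
  f (s1 ++ 0 :: s2) = 0.
Proof.
move=> fc sz; apply: (addrI (f (s1 ++ 0 :: s2))).
by rewrite -(lcochain_add _ _ fc sz) !addr0.
Qed.

Lemma lcochain_sum k f s1 s2 (I : Type) (r : seq I) (a : I -> F) (u : I -> L) :
    lcochain k f -> (size s1 + size s2).+1 = k ->
  f (s1 ++ (\sum_(i <- r) a i *: u i) :: s2) =
  \sum_(i <- r) a i *: f (s1 ++ u i :: s2).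
Proof.
move=> fc sz; elim: r => [|i r IH].
  by rewrite !big_nil (lcochain_zero fc).
by rewrite !big_cons (lcochain_linear fc) // IH.
Qed.

(** The part of the Lie derivative L_x f that comes from the arguments of f. *)
Fixpoint lie_subst x (f : seq L -> M) (s : seq L) : M :=
  if s is y :: s' then f (lie x y :: s') + lie_subst x (fun r => f (y :: r)) s'
  else 0.

(** Cartan's formula i_x d = L_x - d i_x, read as a definition of d by
    induction on the degree; L_x f is [act x] after f minus [lie_subst x f]. *)
Fixpoint cartan_d (f : seq L -> M) (s : seq L) : M :=
  if s is x :: s' then
    act x (f s') - lie_subst x f s' - cartan_d (fun r => f (x :: r)) s'
  else 0.

Lemma lie_subst_linear x f1 f2 f3 s (a : F) :
    (forall r, size r = size s -> f1 r = a *: f2 r + f3 r) ->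
  lie_subst x f1 s = a *: lie_subst x f2 s + lie_subst x f3 s.
Proof.
elim: s f1 f2 f3 => [|y s IH] f1 f2 f3 E /=; first by rewrite scaler0 addr0.
rewrite E // (IH _ (fun r => f2 (y :: r)) (fun r => f3 (y :: r))); last first.
  by move=> r sz; apply: E; rewrite /= sz.
by rewrite scalerDr addrACA.
Qed.

Lemma cartan_d_linear f1 f2 f3 s (a : F) :
    (forall r, (size r).+1 = size s -> f1 r = a *: f2 r + f3 r) ->
  cartan_d f1 s = a *: cartan_d f2 s + cartan_d f3 s.
Proof.
elim: s f1 f2 f3 => [|x s IH] f1 f2 f3 E /=; first by rewrite scaler0 addr0.
rewrite E // (@lie_subst_linear x f1 f2 f3 _ a); last first.
  by move=> r sz; apply: E; rewrite /= sz.
rewrite (IH _ (fun r => f2 (x :: r)) (fun r => f3 (x :: r))); last first.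
  by move=> r sz; apply: E; rewrite /= sz.
by rewrite act_linear_r !opprD !scalerBr !addrA (ACl (1*3*5*2*4*6))%AC.
Qed.

Lemma lie_subst0 x f s : (forall r, size r = size s -> f r = 0) ->
  lie_subst x f s = 0.
Proof.
elim: s f => //= y s IH f f0; rewrite f0 // IH ?addr0 // => r sz.
by apply: f0; rewrite /= sz.
Qed.

Lemma cartan_d0 f s : (forall r, (size r).+1 = size s -> f r = 0) ->
  cartan_d f s = 0.
Proof.
elim: s f => //= x s IH f f0; rewrite f0 // act0r lie_subst0 ?IH ?subr0 //.
  by move=> r sz; apply: f0; rewrite /= sz.
by move=> r sz; apply: f0; rewrite sz.
Qed.

Lemma lie_subst_linear_arg x1 x2 k f s (a : F) : lcochain k f -> size s = k ->
  lie_subst (a *: x1 + x2) f s = a *: lie_subst x1 f s + lie_subst x2 f s.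
Proof.
elim: s k f => [|y s IH] [|k] f //= fc; first by rewrite scaler0 addr0.
case=> sz; rewrite (IH k) //; last exact: lcochain_cons.
rewrite lie_linear_l (lcochain_linear (s1 := [::]) fc) /= ?sz //.
by rewrite scalerDr addrACA.
Qed.

(** When two neighbours are both equal to u, the terms with [x, u] in the first
    and in the second place cancel, and every other term vanishes. *)
Lemma lcochain_lie_subst x k f : lcochain k f -> lcochain k (lie_subst x f).
Proof.
move=> fc; split.
- move=> s1; elim: s1 k f fc => [|y s1 IH] [|k] f fc s2 a u v //= [sz].
    rewrite lie_linear_r (lcochain_linear (s1 := [::]) fc) //= ?sz //.
    rewrite (@lie_subst_linear x _ (fun r => f (u :: r))
               (fun r => f (v :: r)) _ a).
      by rewrite scalerDr addrACA.
    move=> r szr; apply: (lcochain_linear (s1 := [::]) fc).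
    by rewrite /= szr sz.
  rewrite (lcochain_linear (s1 := _ :: _) fc) /= ?sz //.
  by rewrite (IH k) //; [rewrite scalerDr addrACA | exact: lcochain_cons].
- move=> s1; elim: s1 k f fc => [|y s1 IH] [|k] f fc s2 u //= [sz].
    rewrite (lcochain_swap (s1 := [::]) _ _ fc) /= ?sz // addrA addNr add0r.
    apply: lie_subst0 => r szr.
    by rewrite (lcochain_alt (s1 := [::]) fc) //= szr sz.
  rewrite (lcochain_alt (s1 := _ :: _) fc) /= ?add0r -?sz //.
  by rewrite (IH k) //; exact: lcochain_cons.
Qed.

(** Alternation in the first two entries is the identity
    i_u i_u d = i_u L_u - i_u d i_u = i_u L_u - L_u i_u + d i_u i_u = 0; for
    later entries it passes through L_x and through d by induction. *)
Lemma lcochain_cartan_d k f : lcochain k f -> lcochain k.+1 (cartan_d f).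
Proof.
move=> fc; split.
- move=> s1; elim: s1 k f fc => [|x s1 IH] k f fc s2 a u v /= [sz].
    rewrite act_linear_l (lie_subst_linear_arg _ _ _ fc) //.
    rewrite (@cartan_d_linear _ (fun r => f (u :: r))
               (fun r => f (v :: r)) _ a).
      by rewrite !opprD !scalerBr !addrA (ACl (1*3*5*2*4*6))%AC.
    move=> r szr; apply: (lcochain_linear (s1 := [::]) fc).
    by rewrite add0n szr.
  rewrite (lcochain_linear fc) // act_linear_r.
  rewrite (lcochain_linear (lcochain_lie_subst x fc)) //.
  case: k sz fc => // k [sz] fc;
  rewrite (IH k) ?sz //; last exact: lcochain_cons.
  by rewrite !opprD !scalerBr !addrA (ACl (1*3*5*2*4*6))%AC.
- move=> s1; elim: s1 k f fc => [|x s1 IH] k f fc s2 u /= [sz].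
    rewrite liexx (lcochain_zero (s1 := [::]) fc) // add0r.
    rewrite subKr.
    apply: cartan_d0 => r szr.
    by rewrite (lcochain_alt (s1 := [::]) fc) //= add0n szr.
  case: k sz fc => // k [sz] fc; rewrite addSn in sz.
  have sz2 : (size s1 + size s2).+2 = k.+1 by rewrite sz.
  rewrite (lcochain_alt fc) // act0r.
  rewrite (lcochain_alt (lcochain_lie_subst x fc)) // subr0.
  by rewrite (IH k) ?subr0 //; exact: lcochain_cons.
Qed.

End ListCochains.

(** * The Chevalley-Eilenberg differential as a recursion *)

Section Keep.
Variable T : Type.

(** Deletion of entries by position, in a form that reduces along the list:
    positions are shifted in the predicate rather than in the list. *)
Fixpoint keep (P : pred nat) (s : seq T) : seq T :=
  if s is x :: s' then
    if P 0%N then x :: keep (fun m => P m.+1) s' else keep (fun m => P m.+1) s'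
  else [::].

Lemma keepT s : keep xpredT s = s.
Proof. by elim: s => //= x s ->. Qed.

Lemma keepE (x0 : T) P s :
  keep P s = [seq nth x0 s m | m <- iota 0 (size s) & P m].
Proof.
elim: s P => //= x s IH P; rewrite IH (iotaDl 1 0) filter_map.
by case: (P 0%N); rewrite /= -map_comp.
Qed.

Lemma nth_keep_pred1 (x0 : T) s i l :
  (i < size s)%N -> nth x0 (keep (fun m => m != i) s) l = nth x0 s (bump i l).
Proof.
elim: s i l => //= x s IH [|i] l lt_i; first by rewrite keepT.
case: l => [|l] //=; rewrite IH // bumpS //.
Qed.

Lemma size_keep_pred1 s i :
  (i < size s)%N -> (size (keep (fun m => m != i) s)).+1 = size s.
Proof. by elim: s i => //= x s IH [|i] lt_i /=; rewrite ?keepT ?IH. Qed.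

Lemma size_keep_pred2 s i j : (i < j < size s)%N ->
  (size (keep (fun m => (m != i) && (m != j)) s)).+2 = size s.
Proof.
elim: s i j => [|x s IH] [|i] [|j] //=; first by rewrite ltn0 andbF.
  by move=> lt_j; rewrite (@size_keep_pred1 s j).
by move=> lt_ij; rewrite IH.
Qed.

End Keep.

Section Cartan.
Variables (F : fieldType) (L : lieAlgType F) (M : lieModType L).
Implicit Types (f : seq L -> M) (x u v : L) (s y : seq L).

(** The defining formula of the differential, transported to lists. *)
Definition list_d f s : M :=
  \sum_(i < size s) (-1) ^+ i *: act (nth 0 s i) (f (keep (fun m => m != i) s))
  + \sum_(i < size s) \sum_(j < size s | (i < j)%N) (-1) ^+ (i + j) *:
      f (lie (nth 0 s i) (nth 0 s j) :: keep (fun m => (m != i) && (m != j)) s).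

(** Moving the entry [x, y_i] to the front costs i transpositions. *)
Lemma lie_subst_sum k f x s : lcochain k f -> size s = k ->
  lie_subst x f s =
  \sum_(i < size s)
    (-1) ^+ i *: f (lie x (nth 0 s i) :: keep (fun m => m != i) s).
Proof.
elim: s k f => [|y s IH] [|k] f //= fc; first by rewrite big_ord0.
case=> sz; rewrite big_ord_recl /= scale1r keepT; congr (_ + _).
rewrite (IH k) //; last exact: lcochain_cons.
apply: eq_bigr => i _; rewrite (lcochain_swap (s1 := [::]) _ _ fc) /=.
  by rewrite add0n /bump add1n exprS mulN1r scalerN scaleNr.
by rewrite add0n size_keep_pred1 ?sz.
Qed.

(** Separating the terms that involve position 0 from the others: they make up
    L_x f, while the others are those of d(f(x, -)) up to the sign caused by
    the shift of one position.  In the double sum the shifts of i and of j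
    cancel, and the sign comes from exchanging x with [y_i, y_j]. *)
Lemma list_d_cartan k f s : lcochain k f -> size s = k.+1 ->
  list_d f s = cartan_d f s.
Proof.
elim: s k f => // x s IH k f fc [sz]; rewrite [RHS]/=.
have -> : cartan_d (fun r => f (x :: r)) s = list_d (fun r => f (x :: r)) s.
  case: k fc sz => [|k] fc sz; last by rewrite (IH k) //; exact: lcochain_cons.
  by rewrite (size0nil sz) /list_d /= !big_ord0 addr0.
rewrite (lie_subst_sum _ fc) // /list_d /= !big_ord_recl /= scale1r keepT.
rewrite -!addrA; congr (_ + _).
have -> : \sum_(j < (size s).+1 | (0 < j)%N) (-1) ^+ (0 + j) *:
    f (lie x (nth 0 (x :: s) j) :: keep (fun m => m.+1 != j) s) =
    - \sum_(i < size s)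
       (-1) ^+ i *: f (lie x (nth 0 s i) :: keep (fun m => m != i) s).
  rewrite big_mkcond big_ord_recl /= add0r -sumrN; apply: eq_bigr => i _.
  by rewrite add0n /bump add1n exprS mulN1r scaleNr.
rewrite addrCA; congr (_ + _); rewrite opprD; congr (_ + _); rewrite -sumrN.
  by apply: eq_bigr => i _; rewrite /bump add1n exprS mulN1r scaleNr.
apply: eq_bigr => i _; rewrite /bump add1n.
rewrite big_mkcond big_ord_recl /= add0r -sumrN [in RHS]big_mkcond /=.
apply: eq_bigr => j _; rewrite /bump add1n ltnS; case: ifP => //= lt_ij.
rewrite (lcochain_swap (s1 := [::]) _ _ fc) /=.
  by rewrite addnS addSn -signr_odd /= negbK signr_odd scalerN.
by rewrite add0n size_keep_pred2 ?sz // lt_ij ltn_ord.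
Qed.

Definition args_of k s : args L k := [ffun i : 'I_k => nth 0 s i].

Definition list_of k (x : args L k) : seq L := [seq x i | i <- enum 'I_k].

Lemma size_list_of k (x : args L k) : size (list_of x) = k.
Proof. by rewrite size_map size_enum_ord. Qed.

Lemma nth_list_of k (x : args L k) (i : 'I_k) : nth 0 (list_of x) i = x i.
Proof. by rewrite (nth_map i) ?size_enum_ord // nth_ord_enum. Qed.

Lemma list_ofK k : cancel (@list_of k) (@args_of k).
Proof. by move=> x; apply/ffunP=> i; rewrite ffunE nth_list_of. Qed.

Lemma args_ofK k s : size s = k -> list_of (args_of k s) = s.
Proof.
move=> sz; apply: (@eq_from_nth _ 0) => [|i]; rewrite size_list_of // => lt_ik.
by rewrite (nth_list_of _ (Ordinal lt_ik)) ffunE.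
Qed.

Definition list_cochain k (f : fcochain M k) s : M := f (args_of k s).

Lemma lcochain_list k (f : fcochain M k) :
  cochain f -> lcochain k (list_cochain f).
Proof.
case=> fl fa; split=> [s1 s2 a u v sz|s1 s2 u sz]; rewrite /list_cochain.
  have lt1 : (size s1 < k)%N by rewrite -sz ltnS leq_addr.
  have E w : args_of k (s1 ++ w :: s2)
      = set_arg (args_of k (s1 ++ 0 :: s2)) (Ordinal lt1) w.
    apply/ffunP=> l; rewrite !ffunE -val_eqE /= !nth_cat.
    case: ltngtP => // [lt|->]; last by rewrite subnn.
    by move: lt; rewrite -subn_gt0; case: (l - size s1)%N.
  by rewrite (E (_ + _)) (E u) (E v) fl.
have lt1 : (size s1 < k)%N by rewrite -sz ltnS leqW ?leq_addr.
have lt2 : ((size s1).+1 < k)%N by rewrite -sz !ltnS leq_addr.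
apply: (fa _ (Ordinal lt1) (Ordinal lt2)).
  by rewrite -val_eqE /= neq_ltn ltnSn.
by rewrite !ffunE /= !nth_cat ltnn subnn ltnNge leqnSn /= subSnn.
Qed.

Lemma ce_d_cartan k (f : fcochain M k) (x : args L k.+1) : cochain f ->
  ce_d f x = cartan_d (list_cochain f) (list_of x).
Proof.
move=> fc; rewrite -(list_d_cartan (lcochain_list fc)) ?size_list_of //.
rewrite /list_d /ce_d size_list_of; congr (_ + _).
  apply: eq_bigr => i _; rewrite nth_list_of; congr (_ *: act _ (f _)).
  apply/ffunP=> l; rewrite !ffunE nth_keep_pred1 ?size_list_of //.
  by rewrite -(nth_list_of x).
apply: eq_bigr => i _; apply: eq_bigr => j lt_ij; rewrite !nth_list_of.
congr (_ *: f _); apply/ffunP=> l; rewrite !ffunE (keepE 0) size_list_of.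
rewrite -val_enum_ord filter_map -map_comp; congr (nth _ (_ :: _) _).
by apply: eq_map => m /=; rewrite nth_list_of.
Qed.

End Cartan.

(** * Integral linear forms in the coordinates of a cochain *)

Definition cochain_index : Type := (seq nat * nat)%type.
Definition int_form : Type := seq (int * cochain_index).

Definition scalef (a : int) (u : int_form) : int_form :=
  if a == 0 then [::] else [seq (a * p.1, p.2) | p <- u].

Definition sumf (r : seq nat) (u : nat -> int_form) : int_form :=
  flatten (map u r).

Definition substf (u : int_form) (r : cochain_index -> int_form) : int_form :=
  flatten [seq scalef p.1 (r p.2) | p <- u].

(** Forms are not kept reduced, so the coefficient of an index is a sum. *)
Definition coef (u : int_form) (i : cochain_index) : int :=
  foldr (fun p a => if p.2 == i then p.1 + a else a) 0 u.

Definition nullf (u : int_form) : bool := all (fun p => coef u p.2 == 0) u.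

Section Forms.
Variable F : fieldType.
Implicit Types (t : cochain_index -> F) (u v : int_form).

Definition evalf t u : F := \sum_(p <- u) p.1%:~R * t p.2.

Lemma evalf_cat t u v : evalf t (u ++ v) = evalf t u + evalf t v.
Proof. exact: big_cat. Qed.

Lemma evalf_scale t a u : evalf t (scalef a u) = a%:~R * evalf t u.
Proof.
rewrite /scalef /evalf; case: eqP => [->|_]; first by rewrite big_nil mul0r.
rewrite big_map mulr_sumr; apply: eq_bigr => p _.
by rewrite intrM mulrA.
Qed.

Lemma evalf_sum t n (u : nat -> int_form) :
  evalf t (sumf (iota 0 n) u) = \sum_(a < n) evalf t (u a).
Proof.
rewrite -(big_mkord xpredT (fun a => evalf t (u a))) /index_iota subn0 /sumf.
elim: (iota 0 n) => [|a r IH] /=; first by rewrite /evalf !big_nil.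
by rewrite evalf_cat IH big_cons.
Qed.

Lemma evalf_subst t u (r : cochain_index -> int_form) :
  evalf t (substf u r) = evalf (fun i => evalf t (r i)) u.
Proof.
rewrite /substf; elim: u => [|p u IH] /=; first by rewrite /evalf !big_nil.
by rewrite evalf_cat evalf_scale IH [in RHS]/evalf big_cons.
Qed.

Lemma evalf_nil t : evalf t [::] = 0. Proof. exact: big_nil. Qed.

Lemma eq_evalf t1 t2 u :
  (forall p, p \in u -> t1 p.2 = t2 p.2) -> evalf t1 u = evalf t2 u.
Proof. by move=> E; apply: eq_big_seq => p /E ->. Qed.

Lemma evalf_coef t u (I : seq cochain_index) :
    uniq I -> {subset map snd u <= I} ->
  evalf t u = \sum_(i <- I) (coef u i)%:~R * t i.
Proof.
move=> uI; elim: u => [_|p u IH sub].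
  by rewrite evalf_nil big1 // => i _; rewrite mul0r.
rewrite /evalf big_cons -/(evalf t u) IH; last first.
  by move=> i iu; apply: sub; rewrite inE iu orbT.
have pI : p.2 \in I by apply: sub; rewrite inE eqxx.
rewrite (bigD1_seq p.2) //= [RHS](bigD1_seq p.2) //= eqxx intrD mulrDl addrA.
congr (_ + _); apply: eq_bigr => i /negbTE ne.
by rewrite eq_sym ne.
Qed.

(** The bridge between computation and algebra: [nullf u] is decided by
    evaluation on integers, and it annihilates u over every field. *)
Lemma evalf_null t u : nullf u -> evalf t u = 0.
Proof.
move/allP=> u0; rewrite (@evalf_coef t u (undup (map snd u))) ?undup_uniq //.
  rewrite big_seq big1 // => i; rewrite mem_undup => /mapP[p pu ->].
  by rewrite (eqP (u0 p pu)) mul0r.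
by move=> i; rewrite mem_undup.
Qed.

End Forms.

(** * Sorted index lists *)

Fixpoint insert (a : nat) (s : seq nat) : seq nat :=
  if s is y :: s' then if (y < a)%N then y :: insert a s' else a :: s
  else [:: a].

Fixpoint passes (a : nat) (s : seq nat) : nat :=
  if s is y :: s' then if (y < a)%N then (passes a s').+1 else 0 else 0.

Fixpoint isort (s : seq nat) : seq nat :=
  if s is a :: s' then insert a (isort s') else [::].

Fixpoint inversions (s : seq nat) : nat :=
  if s is a :: s' then (passes a (isort s') + inversions s')%N else 0.

Lemma perm_insert a s : perm_eq (insert a s) (a :: s).
Proof.
elim: s => //= y s IH; case: ifP => // _.
apply: (@perm_trans _ [:: y, a & s]); first by rewrite perm_cons.
exact/permPl/(perm_catCA [:: y] [:: a] s).
Qed.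

Lemma perm_isort s : perm_eq (isort s) s.
Proof.
elim: s => //= a s IH; apply: perm_trans (perm_insert _ _) _.
by rewrite perm_cons.
Qed.

Lemma isort_sorted s : sorted leq (isort s).
Proof.
elim: s => //= a s; elim: (isort s) => //= y r IH ry.
case: ltnP => [lt_ya|le_ay] /=; last by rewrite le_ay.
have := IH (path_sorted ry); case: r ry {IH} => [|z r] /=.
  by rewrite (ltnW lt_ya).
case/andP=> le_yz _; case: ltnP => _ /= ->; by rewrite ?le_yz ?(ltnW lt_ya).
Qed.

(** In a sorted list equal entries are adjacent, which is where alternation
    applies. *)
Lemma sorted_repeat s : sorted leq s -> ~~ uniq s ->
  exists s1 s2 a, s = s1 ++ a :: a :: s2.
Proof.
elim: s => //= x s IH xs; rewrite negb_and negbK => /orP[xins|nu]; last first.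
  by have [s1 [s2 [a ->]]] := IH (path_sorted xs) nu; exists (x :: s1), s2, a.
case: s xs xins {IH} => //= y s /andP[le_xy ys] xins.
suff -> : x = y by exists [::], s, y.
apply/eqP; rewrite eqn_leq le_xy /=; move: xins; rewrite inE => /orP[/eqP->//|].
by have /allP le_y := order_path_min leq_trans ys => /le_y.
Qed.

Fixpoint subseqs (s : seq nat) : seq (seq nat) :=
  if s is x :: s' then [seq x :: r | r <- subseqs s'] ++ subseqs s'
  else [:: [::]].

Lemma mem_subseqs s r : (r \in subseqs s) = subseq r s.
Proof.
elim: s r => [|x s IH] [|y r] //=.
  by rewrite mem_cat IH sub0seq orbT.
rewrite mem_cat IH; case: eqP => [->|ne].
  rewrite mem_map ?IH; last by move=> ? ? [].
  by rewrite orb_idr // => /cons_subseq.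
by rewrite orb_idl // => /mapP[? _ []].
Qed.

Lemma uniq_subseqs s : uniq s -> uniq (subseqs s).
Proof.
elim: s => //= x s IH /andP[xs us]; rewrite cat_uniq IH // andbT.
rewrite map_inj_uniq ?IH //=; last by move=> ? ? [].
apply/hasPn => r; rewrite mem_subseqs => rs; apply: contra xs.
by case/mapP=> q _ E; apply: (mem_subseq rs); rewrite E inE eqxx.
Qed.

Lemma sorted_subseq_iota n s :
  sorted ltn s -> all (fun a => (a < n)%N) s -> subseq s (iota 0 n).
Proof.
move=> ss /allP sn.
suff -> : s = filter [in s] (iota 0 n) by exact: filter_subseq.
apply: (irr_sorted_eq ltn_trans ltnn) => //.
  by apply: sorted_filter; [exact: ltn_trans | exact: iota_ltn_sorted].
move=> a; rewrite mem_filter mem_iota /= add0n.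
by case as_: (a \in s) => //=; rewrite (sn _ as_).
Qed.

(** The index (s, m) stands for the coordinate along the m-th basis vector of
    the value at the basis vectors listed in s. *)
Definition increasing (n k : nat) (i : cochain_index) : bool :=
  [&& size i.1 == k, sorted ltn i.1, all (fun a => (a < n)%N) i.1
    & (i.2 < n)%N].

Definition indices (n k : nat) : seq cochain_index :=
  [seq (s, m) | s <- [seq s <- subseqs (iota 0 n) | size s == k],
                m <- iota 0 n].

Lemma mem_indices n k i : increasing n k i -> i \in indices n k.
Proof.
case: i => s m /and4P[/= sz ss sn mn]; apply/allpairsP; exists (s, m).
by rewrite mem_filter sz mem_subseqs sorted_subseq_iota // mem_iota.
Qed.

(** * Cochains in coordinates *)

Record structured_basis (F : fieldType) (L : lieAlgType F) (n : nat)
    (c : nat -> nat -> nat -> int) (b : nat -> L) (co : nat -> L -> F) : Prop :=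
  StructuredBasis {
    basis_coord_linear : forall m (a : F) u v,
      co m (a *: u + v) = a * co m u + co m v;
    basis_coordE : forall i j, (i < n)%N -> (j < n)%N ->
      co i (b j) = (i == j)%:R;
    basis_expand : forall x, x = \sum_(m < n) co m x *: b m;
    lie_basis : forall i j, (i < n)%N -> (j < n)%N ->
      lie (b i) (b j) = \sum_(m < n) (c i j m)%:~R *: b m }.

(** The coordinate (s, m) for an unsorted s, as a signed coordinate whose list
    is sorted. *)
Definition key_form (s : seq nat) (m : nat) : int_form :=
  if uniq s then [:: ((-1) ^+ odd (inversions s), (isort s, m))] else [::].

Section Differential.
Variables (n : nat) (c : nat -> nat -> nat -> int).

(** The recursions below follow [lie_subst] and [cartan_d] on lists of indices.
    The list p records the arguments already fixed, which the recursion on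
    functions stores in f. *)
Fixpoint subst_form (p : seq nat) (x : nat) (s : seq nat) (m : nat) :
    int_form :=
  if s is y :: s' then
    sumf (iota 0 n) (fun a => scalef (c x y a) (key_form (p ++ a :: s') m))
    ++ subst_form (rcons p y) x s' m
  else [::].

Fixpoint cartan_form (p s : seq nat) (m : nat) : int_form :=
  if s is x :: s' then
    sumf (iota 0 n) (fun q => scalef (c x q m) (key_form (p ++ s') q))
    ++ scalef (-1) (subst_form p x s' m)
    ++ scalef (-1) (cartan_form (rcons p x) s' m)
  else [::].

Definition d_form (i : cochain_index) : int_form := cartan_form [::] i.1 i.2.

End Differential.

Section Coordinates.
Variables (F : fieldType) (L : lieAlgType F) (n : nat).
Variables (c : nat -> nat -> nat -> int) (b : nat -> L) (co : nat -> L -> F).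
Hypothesis B : structured_basis n c b co.
Local Notation M := (adjoint L).
Implicit Types (f : seq L -> M) (s p : seq nat).

Lemma basis_coordD m u v : co m (u + v) = co m u + co m v.
Proof. by rewrite -{1}[u]scale1r (basis_coord_linear B) mul1r. Qed.

Lemma basis_coord0 m : co m 0 = 0.
Proof. by apply: (addrI (co m 0)); rewrite -basis_coordD !addr0. Qed.

Lemma basis_coordZ m a u : co m (a *: u) = a * co m u.
Proof. by rewrite -[a *: u]addr0 (basis_coord_linear B) basis_coord0 addr0. Qed.

Lemma basis_coordN m u : co m (- u) = - co m u.
Proof. by rewrite -scaleN1r basis_coordZ mulN1r. Qed.

Lemma basis_coord_sum m (I : Type) (r : seq I) (P : pred I) (E : I -> L) :
  co m (\sum_(i <- r | P i) E i) = \sum_(i <- r | P i) co m (E i).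
Proof. exact: (big_morph _ (basis_coordD m) (basis_coord0 m)). Qed.

Lemma basis_coord_expand m (u : nat -> F) : (m < n)%N ->
  co m (\sum_(q < n) u q *: b q) = u m.
Proof.
move=> mn; rewrite basis_coord_sum (bigD1 (Ordinal mn)) //= basis_coordZ.
rewrite (basis_coordE B) // eqxx mulr1 big1 ?addr0 // => q.
rewrite -val_eqE /= => ne.
by rewrite basis_coordZ (basis_coordE B) // eq_sym (negbTE ne) mulr0.
Qed.

Definition cochain_coord f (i : cochain_index) : F := co i.2 (f (map b i.1)).

Lemma cochain_insert k f p a s : lcochain k f -> (size p + size s).+1 = k ->
  f (map b (p ++ a :: s)) = (-1) ^+ passes a s *: f (map b (p ++ insert a s)).
Proof.
move=> fc; elim: s p => [|y s IH] p /= sz; first by rewrite scale1r.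
case: ifP => _; last by rewrite scale1r.
rewrite map_cat /= (lcochain_swap _ _ fc) ?size_map -?sz ?addnS //.
have := IH (rcons p y); rewrite !cat_rcons map_cat /= => ->.
  by rewrite exprS mulN1r scaleNr.
by rewrite size_rcons -sz addnS.
Qed.

(** The prefix p is there for the induction, which sorts the tail of a list
    before inserting its head. *)
Lemma cochain_isort k f p s : lcochain k f -> (size p + size s)%N = k ->
  f (map b (p ++ s)) = (-1) ^+ inversions s *: f (map b (p ++ isort s)).
Proof.
move=> fc; elim: s p => [|a s IH] p /= sz; first by rewrite scale1r.
rewrite -cat_rcons IH ?size_rcons -?sz ?addnS // cat_rcons.
rewrite (@cochain_insert k) // ?(perm_size (perm_isort s)) -?sz ?addnS //.
by rewrite scalerA -exprD addnC.
Qed.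

Lemma cochain_repeat k f s : lcochain k f -> size s = k -> ~~ uniq s ->
  f (map b s) = 0.
Proof.
move=> fc sz nu; rewrite -[s]cat0s (cochain_isort fc) //=.
have [|s1 [s2 [a E]]] := sorted_repeat (isort_sorted s).
  by rewrite (perm_uniq (perm_isort s)).
have := perm_size (perm_isort s).
rewrite E sz size_cat /= => sz2.
by rewrite map_cat (lcochain_alt fc) ?scaler0 // !size_map -sz2 !addnS.
Qed.

Lemma evalf_key k f s m : lcochain k f -> size s = k ->
  evalf (cochain_coord f) (key_form s m) = co m (f (map b s)).
Proof.
move=> fc sz; rewrite /key_form; case: ifP => [_|/negbT nu]; last first.
  by rewrite evalf_nil (cochain_repeat fc) // basis_coord0.
rewrite /evalf big_seq1 /cochain_coord /= -[in RHS](cat0s s).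
rewrite (cochain_isort fc) //.
by rewrite basis_coordZ -[in RHS]signr_odd rmorphXn /= rmorphN1.
Qed.

Lemma evalf_subst_form k f p x s m :
    lcochain k f -> (size p + size s)%N = k -> (x < n)%N ->
    all (fun a => (a < n)%N) s ->
  evalf (cochain_coord f) (subst_form n c p x s m) =
  co m (lie_subst (b x) (fun r => f (map b p ++ r)) (map b s)).
Proof.
move=> fc + xn; elim: s p => [|y s IH] p /= sz.
  by rewrite evalf_nil basis_coord0.
case/andP=> yn sn; rewrite evalf_cat IH ?size_rcons -?sz ?addnS // basis_coordD.
have -> : (fun r => f (map b (rcons p y) ++ r))
          = (fun r => f (map b p ++ b y :: r)).
  by apply: funext => r; rewrite map_rcons cat_rcons.
congr (_ + _).
rewrite (lie_basis B) // (lcochain_sum _ _ _ fc) ?size_map -?sz ?addnS //.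
rewrite basis_coord_sum evalf_sum; apply: eq_bigr => a _.
rewrite evalf_scale basis_coordZ (evalf_key _ fc) ?map_cat //.
by rewrite size_cat -sz.
Qed.

Lemma evalf_cartan_form k f p s m :
    lcochain k f -> (size p + size s)%N = k.+1 -> (m < n)%N ->
    all (fun a => (a < n)%N) s ->
  evalf (cochain_coord f) (cartan_form n c p s m) =
  co m (cartan_d (fun r => f (map b p ++ r)) (map b s)).
Proof.
move=> fc + mn; elim: s p => [|x s IH] p /= sz.
  by rewrite evalf_nil basis_coord0.
case/andP=> xn sn; rewrite addnS in sz; case: sz => sz.
rewrite !evalf_cat !evalf_scale !mulN1r IH ?size_rcons -?sz ?addSn //.
rewrite (evalf_subst_form _ fc) // !basis_coordD !basis_coordN addrA.
have -> : (fun r => f (map b (rcons p x) ++ r))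
          = (fun r => f (map b p ++ b x :: r)).
  by apply: funext => r; rewrite map_rcons cat_rcons.
congr (_ - _ - _).
rewrite evalf_sum -map_cat {1}[f _](basis_expand B).
rewrite -[act _ _]/(lie _ _).
have lie_sum (r : seq 'I_n) (a : 'I_n -> F) :
    lie (b x) (\sum_(q <- r) a q *: b q) = \sum_(q <- r) a q *: lie (b x) (b q).
  elim: r => [|q r IHr]; last by rewrite !big_cons lie_linear_r IHr.
  rewrite !big_nil; apply: (addrI (lie (b x) 0)).
  by rewrite -lieDr !addr0.
rewrite lie_sum basis_coord_sum; apply: eq_bigr => q _.
rewrite evalf_scale basis_coordZ (lie_basis B) //.
rewrite (basis_coord_expand (fun a => (c x q a)%:~R)) // mulrC.
by rewrite (evalf_key _ fc) // size_cat sz.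
Qed.

Lemma evalf_d_form k f i : lcochain k f -> increasing n k.+1 i ->
  evalf (cochain_coord f) (d_form n c i) = cochain_coord (cartan_d f) i.
Proof.
case: i => s m fc /and4P[/= /eqP sz _ sn mn].
by rewrite (evalf_cartan_form (k := k)).
Qed.

(** Multilinearity replaces the arguments by basis vectors one at a time, from
    left to right; the resulting list is then sorted, or has a repetition. *)
Lemma lcochain_eq0 k f : lcochain k f ->
  (forall i, increasing n k i -> cochain_coord f i = 0) ->
  forall s : seq L, size s = k -> f s = 0.
Proof.
move=> fc f0.
suff H (s : seq L) p : all (fun a => (a < n)%N) p -> (size p + size s)%N = k ->
    f (map b p ++ s) = 0.
  by move=> s sz; apply: (H s [::]).
elim: s p => [|x s IH] p pn sz.
  rewrite addn0 in sz; rewrite cats0.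
  case up: (uniq p); last by rewrite (cochain_repeat fc) ?up.
  rewrite -[p]cat0s (cochain_isort fc) //=.
  rewrite [f _](basis_expand B) big1 ?scaler0 //.
  move=> m _; rewrite -/(cochain_coord f (isort p, val m)) f0 ?scale0r //.
  apply/and4P; split=> //=; first by rewrite (perm_size (perm_isort p)) sz.
    by rewrite ltn_sorted_uniq_leq (perm_uniq (perm_isort p)) up isort_sorted.
  by rewrite (perm_all _ (perm_isort p)).
rewrite [x](basis_expand B) (lcochain_sum _ _ _ fc) ?size_map -?sz ?addnS //.
apply: big1 => m _; rewrite -cat_rcons -map_rcons IH ?scaler0 //.
  by rewrite all_rcons ltn_ord.
by rewrite size_rcons -sz addnS.
Qed.

(** The minors with columns s are the exterior products of the coordinate forms
    listed in s, evaluated at x. *)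
Definition minor k s (x : args L k) : F :=
  \det (\matrix_(i < k, j < k) co (nth 0%N s j) (x i)).

Definition wedge_cochain k (t : cochain_index -> F) : fcochain M k := fun x =>
  \sum_(s <- subseqs (iota 0 n) | size s == k)
     minor s x *: (\sum_(m < n) t (s, val m) *: b m).

Lemma cochain_wedge k t : cochain (@wedge_cochain k t).
Proof.
split=> [x i a u v|x i j ne eq_x]; rewrite /wedge_cochain.
  rewrite scaler_sumr -big_split; apply: eq_bigr => s _ /=.
  rewrite scalerA -scalerDl; congr (_ *: _).
  rewrite -[minor s (set_arg x i v)]mul1r.
  apply: (@determinant_multilinear _ _ _ _ _ i).
  - apply/rowP=> j; rewrite !mxE !ffunE eqxx mul1r.
    exact: (basis_coord_linear B).
  - by apply/matrixP=> l j; rewrite !mxE !ffunE eq_sym (negbTE (neq_lift _ _)).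
  - by apply/matrixP=> l j; rewrite !mxE !ffunE eq_sym (negbTE (neq_lift _ _)).
apply: big1 => s _; rewrite /minor (determinant_alternate ne) ?scale0r //.
by move=> l; rewrite !mxE eq_x.
Qed.

(** If s and s' differ, some entry of s' is not in s and gives a zero row. *)
Lemma minor_basis k s s' : sorted ltn s -> sorted ltn s' ->
    all (fun a => (a < n)%N) s -> all (fun a => (a < n)%N) s' ->
    size s = k -> size s' = k ->
  minor s (args_of k (map b s')) = (s == s')%:R.
Proof.
move=> ss ss' /allP sn /allP sn' <- /esym sz.
have us := sorted_uniq ltn_trans ltnn ss.
have us' := sorted_uniq ltn_trans ltnn ss'.
have E (i j : 'I_(size s)) :
    co (nth 0%N s j) (args_of (size s) (map b s') i)
    = (nth 0%N s j == nth 0%N s' i)%:R.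
  have lt_i : (i < size s')%N by rewrite -sz.
  rewrite ffunE (nth_map 0%N) // (basis_coordE B) //; first exact/sn/mem_nth.
  exact/sn'/mem_nth.
case: eqP => [eq_s|ne].
  rewrite -[RHS](det1 F (size s)) /minor; congr determinant.
  by apply/matrixP=> i j; rewrite !mxE E -eq_s nth_uniq // eq_sym.
have /allPn[a as' nas] : ~~ all [in s] s'.
  apply/negP=> /allP sub; apply: ne.
  apply: (irr_sorted_eq ltn_trans ltnn) => //.
  have [] := uniq_min_size us' sub; first by rewrite sz.
  by move=> _ eq_mem x; rewrite eq_mem.
have lt_a : (index a s' < size s)%N by rewrite sz index_mem.
rewrite /minor (expand_det_row _ (Ordinal lt_a)) big1 // => j _.
rewrite mxE E /= nth_index //; case: eqP => [Ea|]; last by rewrite mul0r.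
by case/negP: nas; rewrite -Ea mem_nth.
Qed.

Lemma wedge_coord k t i : increasing n k i ->
  cochain_coord (list_cochain (@wedge_cochain k t)) i = t i.
Proof.
case: i => s m /and4P[/= /eqP sz ss sn mn].
rewrite /cochain_coord /list_cochain /wedge_cochain /=.
have u : uniq (subseqs (iota 0 n)) by rewrite uniq_subseqs ?iota_uniq.
rewrite -big_filter (bigD1_seq s) ?filter_uniq //=; last first.
  by rewrite mem_filter sz eqxx mem_subseqs sorted_subseq_iota.
rewrite minor_basis // eqxx scale1r.
rewrite [X in _ + X]big1_seq ?addr0.
  by rewrite (basis_coord_expand (fun q => t (s, q))).
move=> s' /andP[ne]; rewrite mem_filter => /andP[/eqP sz'].
rewrite mem_subseqs => sub; rewrite minor_basis //.
- by rewrite (negbTE ne) scale0r.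
- by apply: (subseq_sorted ltn_trans sub); exact: iota_ltn_sorted.
- apply/allP=> a /(mem_subseq sub); by rewrite mem_iota.
Qed.

End Coordinates.

(** * Cohomology from a contracting homotopy *)

(** A nonzero functional with kernel S identifies the quotient by S with the
    base field. *)
Lemma lquot_line (F : fieldType) (V : lmodType F) (S : submodClosed V)
    (lam : V -> F) :
    (forall a u v, lam (a *: u + v) = a * lam u + lam v) ->
    (forall v, v \in S <-> lam v = 0) -> (exists v, lam v != 0) ->
  lmod_iso (lquot S) F^o.
Proof.
move=> lin ker [w w0].
have lamZ a u : lam (a *: u) = a * lam u.
  have l0 : lam 0 = 0 by apply/ker; exact: rpred0.
  by rewrite -[a *: u]addr0 lin l0 addr0.
pose phi (x : lquot S) : F^o := lam (repr x).
have phi_pi v : phi (lquot_pi S v) = lam v.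
  apply/eqP; rewrite -subr_eq0 -mulN1r addrC -lin; apply/eqP/ker.
  by rewrite -lquot_pi_eq0 linearP /= lquot_pi_repr scaleN1r addNr.
have phi_lin : linear phi.
  move=> a x y; rewrite -(lquot_pi_repr x) -(lquot_pi_repr y) -linearP !phi_pi.
  exact: lin.
pose Phi : {linear lquot S -> F^o} :=
  HB.pack phi (GRing.isLinear.Build F (lquot S) F^o *:%R phi phi_lin).
exists Phi; exists (fun a => lquot_pi S ((a / lam w) *: w)) => [x|a] /=.
  apply/eqP; rewrite -subr_eq0 -{2}(lquot_pi_repr x) -linearB lquot_pi_eq0.
  by apply/ker; rewrite lin -scaleN1r lamZ mulN1r divfK // subrr.
by rewrite phi_pi lamZ divfK.
Qed.

Section Certificate.
Variables (n : nat) (c : nat -> nat -> nat -> int) (N : int).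
Variable (h : cochain_index -> int_form).

(** The identity N = d h + h d + z ell in degree k, checked row by row: d and h
    are given by the linear forms that compute each coordinate of the image.
    The first two conditions say that these forms only involve coordinates of
    the right degree. *)
Definition homotopy_check (k : nat) (z ell : int_form) : bool :=
  all (fun i =>
    [&& all (fun p => increasing n k.-1 p.2) (d_form n c i),
        all (fun p => increasing n k.+1 p.2) (h i) &
        nullf ((N, i) :: scalef (-1) (substf (d_form n c i) h)
               ++ scalef (-1) (substf (h i) (d_form n c))
               ++ scalef (- coef z i) ell)]) (indices n k).

Definition pairing (z u : int_form) : int :=
  foldr (fun p a => p.1 * coef z p.2 + a) 0 u.

(** The identities ell d = 0, d z = 0 and ell z = N. *)
Definition class_check (k : nat) (z ell : int_form) : bool :=
  [&& all (fun p => increasing n k p.2) ell, nullf (substf ell (d_form n c)),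
      all (fun i => all (fun p => increasing n k p.2) (d_form n c i)
                    && (pairing z (d_form n c i) == 0)) (indices n k.+1) &
      pairing z ell == N].

Variables (F : fieldType) (L : lieAlgType F).
Variables (b : nat -> L) (co : nat -> L -> F).
Hypothesis B : structured_basis n c b co.
Hypothesis N0 : N%:~R != 0 :> F.
Local Notation M := (adjoint L).
Local Notation coords f := (cochain_coord b co (list_cochain f)).

Lemma evalf_pairing z u :
  evalf (fun i => (coef z i)%:~R) u = (pairing z u)%:~R :> F.
Proof.
elim: u => [|p u IH]; first by rewrite evalf_nil.
by rewrite /= intrD intrM -IH; exact: big_cons.
Qed.

Lemma coords_ce_d k (f : fcochain M k) i : cochain f -> increasing n k.+1 i ->
  coords (ce_d f) i = evalf (coords f) (d_form n c i).
Proof.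
move=> fc gi; have /and4P[/eqP sz _ _ _] := gi.
rewrite (evalf_d_form B (lcochain_list fc)) // /cochain_coord; congr (co _ _).
by rewrite /list_cochain (ce_d_cartan _ fc) args_ofK ?size_map.
Qed.

Lemma lcochain_ce_d k (f : fcochain M k) : cochain f ->
  lcochain k.+1 (cartan_d (list_cochain f)).
Proof. by move=> fc; apply/lcochain_cartan_d/lcochain_list. Qed.

(** The difference of the two sides is alternating and multilinear by
    [lcochain_cartan_d], so it may be tested on increasing basis lists. *)
Lemma eq_ce_d k (f : fcochain M k) (g : fcochain M k.+1) :
    cochain f -> cochain g ->
    (forall i, increasing n k.+1 i ->
       coords g i = evalf (coords f) (d_form n c i)) ->
  g = ce_d f.
Proof.
move=> fc gc E; have dc := lcochain_ce_d fc; have gl := lcochain_list gc.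
pose r s := - 1 *: cartan_d (list_cochain f) s + list_cochain g s : M.
have rc : lcochain k.+1 r.
  split=> [s1 s2 a u v sz|s1 s2 u sz]; rewrite /r.
    rewrite (lcochain_linear dc) // (lcochain_linear gl) // !scalerDr addrACA.
    by rewrite !scalerA mulrC.
  by rewrite (lcochain_alt dc) // (lcochain_alt gl) // scaler0 addr0.
apply: funext => x; rewrite (ce_d_cartan _ fc).
have := lcochain_eq0 B rc _ (size_list_of x); rewrite /r => r0.
apply/esym/eqP; rewrite -subr_eq0 -oppr_eq0 opprB addrC -scaleN1r; apply/eqP.
rewrite -[in X in _ + X](list_ofK x); apply: r0 => i gi.
have := E i gi; rewrite (evalf_d_form B (lcochain_list fc)) // /cochain_coord.
by rewrite (basis_coord_linear B) => ->; rewrite mulN1r addNr.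
Qed.

(** On a cocycle f with ell f = 0 the identity reduces to N f = d (h f). *)
Lemma coboundary_of_homotopy k z ell (f : fcochain M k) :
    homotopy_check k z ell -> cochain f -> ce_d f = 0 ->
  evalf (coords f) ell = 0 -> coboundary f.
Proof.
move=> /allP chk fc df0 ell0.
have id_h i : increasing n k i -> N%:~R * coords f i =
    evalf (fun j => evalf (coords f) (h j)) (d_form n c i).
  move=> gi; have /and3P[_ /allP hgood /(evalf_null (coords f))] :=
    chk i (mem_indices gi).
  rewrite -cat1s !evalf_cat !evalf_scale ell0 mulr0 addr0 !evalf_subst.
  rewrite /evalf big_seq1 /= -!/(evalf _ _) !mulN1r.
  rewrite [X in _ + (_ - X) = 0 -> _](_ : _ = 0) ?subr0; last first.
    rewrite /evalf big_seq big1 // => p ph.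
    rewrite -/(evalf _ _) -coords_ce_d //; last exact: hgood.
    by rewrite df0 /cochain_coord /list_cochain (basis_coord0 B) mulr0.
  by move/eqP; rewrite subr_eq0 => /eqP.
have NV : N%:~R^-1 * N%:~R = 1 :> F by rewrite mulVf.
case: k f chk fc df0 ell0 id_h => [|k] f chk fc df0 ell0 id_h /=.
  apply: funext => x; rewrite -(list_ofK x).
  apply: (lcochain_eq0 B (lcochain_list fc)); last exact: size_list_of.
  case=> s m gi; have := id_h _ gi.
  have /and4P[/= /nilP-> _ _ _] := gi; rewrite evalf_nil => /eqP.
  by rewrite mulf_eq0 (negbTE N0) => /eqP.
pose t j := N%:~R^-1 * evalf (coords f) (h j).
have gc := cochain_wedge B k t.
exists (@wedge_cochain _ _ n b co k t) => //; apply: eq_ce_d => // i gi.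
have /and3P[/allP dgood _ _] := chk i (mem_indices gi).
rewrite (@eq_evalf _ _ t) => [|p /dgood gp]; last exact: (wedge_coord B).
rewrite -[LHS]mul1r -NV -mulrA id_h // /evalf mulr_sumr; apply: eq_bigr => p _.
by rewrite mulrCA.
Qed.

Lemma cohomology_eq0 k : homotopy_check k [::] [::] ->
  forall x : cohomology M k, x = 0.
Proof.
move=> chk x; rewrite -(lquot_pi_repr x); apply/eqP; rewrite lquot_pi_eq0.
apply/asboolP; case: (repr x) => f fz /=; have /asboolP[fc df] := fz.
by apply: (coboundary_of_homotopy chk) => //; rewrite evalf_nil.
Qed.

Lemma cohomology_line k z ell :
    homotopy_check k.+1 z ell -> class_check k.+1 z ell ->
  lmod_iso (cohomology M k.+1) F^o.
Proof.
move=> hchk /and4P[/allP ellgood ell_d /allP zcyc /eqP pair].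
apply: (@lquot_line _ _ _ (fun f : cocycles M k.+1 => evalf (coords f) ell)).
- move=> a u v; rewrite /evalf mulr_sumr -big_split; apply: eq_bigr => p _ /=.
  by rewrite mulrCA -mulrDr; congr (_ * _); exact: (basis_coord_linear B).
- case=> f fz; have /asboolP[fc df] := fz; split=> [/asboolP[g gc /= ->]|ell0].
    rewrite -(evalf_null (coords g) ell_d) evalf_subst; apply: eq_evalf => p pu.
    by rewrite coords_ce_d //; exact: ellgood.
  by apply/asboolP; apply: (coboundary_of_homotopy hchk).
pose f := @wedge_cochain _ _ n b co k.+1 (fun i => (coef z i)%:~R).
have fc : cochain f by exact: cochain_wedge B _ _.
have f_coords i : increasing n k.+1 i -> coords f i = (coef z i)%:~R.
  exact: (wedge_coord B).
have df : ce_d f = 0.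
  apply/esym; apply: eq_ce_d => // [|i gi]; first exact: cochain0.
  have /andP[/allP dgood /eqP z0] := zcyc i (mem_indices gi).
  rewrite (@eq_evalf _ _ (fun i => (coef z i)%:~R)) => [|p /dgood]; last first.
    exact: f_coords.
  by rewrite evalf_pairing z0 /cochain_coord (basis_coord0 B).
have fz : cocycle f by apply/asboolP.
exists (Cocycle fz); rewrite /= (@eq_evalf _ _ (fun i => (coef z i)%:~R)).
  by rewrite evalf_pairing pair.
by move=> p /ellgood; exact: f_coords.
Qed.

End Certificate.

(** * The Lie algebra sl2 and its irreducible module of dimension 3 *)

(** [e, h] = - 2 e, [h, f] = - 2 f, [e, f] = h, with e, h, f numbered 0, 1,
    2. *)
Definition sl2_const (i j m : nat) : int :=
  match i, j, m with
  | 0, 1, 0 => -2%Z | 1, 0, 0 => 2%Z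
  | 1, 2, 2 => -2%Z | 2, 1, 2 => 2%Z
  | 0, 2, 1 => 1%Z | 2, 0, 1 => -1%Z
  | _, _, _ => 0%Z
  end%N.

Section SL2.
Variable F : fieldType.

Definition sl2_mx (a b c : F) : 'M[F]_2 :=
  \matrix_(i < 2, j < 2)
    if i == 0 then if j == 0 then a else b else if j == 0 then c else - a.

Fact traceless_sl2_mx a b c : traceless (sl2_mx a b c).
Proof.
by rewrite /traceless /mxtrace !big_ord_recl big_ord0 !mxE /= addr0 subrr.
Qed.

Definition sl2 a b c : sl F 2 := SL (traceless_sl2_mx a b c).

Definition sl2_basis (i : nat) : sl F 2 :=
  match i with 0%N => sl2 0 1 0 | 1%N => sl2 1 0 0 | _ => sl2 0 0 1 end.

Definition sl2_coord (i : nat) (x : sl F 2) : F :=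
  match i with
  | 0%N => slval x 0 1 | 1%N => slval x 0 0 | _ => slval x 1 0 end.

Lemma sl2E (x : sl F 2) :
  x = sl2 (sl2_coord 1 x) (sl2_coord 0 x) (sl2_coord 2 x).
Proof.
apply: val_inj; apply/matrixP=> i j; rewrite /= mxE.
have /eqP tr : traceless (slval x) by case: x.
have {}tr : slval x 1 1 = - slval x 0 0.
  apply/eqP; rewrite -addr_eq0 addrC -tr /mxtrace !big_ord_recl big_ord0 addr0.
  by apply/eqP; congr (_ + slval x _ _); apply: val_inj.
case: (unliftP 0 i) => [i' ->|->]; case: (unliftP 0 j) => [j' ->|->];
  rewrite ?eqxx ?(ord1 i') ?(ord1 j') //=.
- by rewrite -tr; congr (slval x _ _); apply: val_inj.
- by congr (slval x _ _); apply: val_inj.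
- by congr (slval x _ _); apply: val_inj.
Qed.

Lemma lie_sl2 a b c a' b' c' : lie (sl2 a b c) (sl2 a' b' c') =
  sl2 (b * c' - b' * c) (2 * (a * b' - a' * b)) (2 * (c * a' - c' * a)).
Proof.
rewrite [LHS]sl2E; congr sl2;
  by rewrite /= !mxE !big_ord_recl !big_ord0 !mxE /=; ring.
Qed.

Lemma sl2_comb x y z a b c a' b' c' a'' b'' c'' :
  x *: sl2 a b c + (y *: sl2 a' b' c' + z *: sl2 a'' b'' c'') =
  sl2 (x * a + (y * a' + z * a'')) (x * b + (y * b' + z * b''))
      (x * c + (y * c' + z * c'')).
Proof.
by rewrite [LHS]sl2E; congr sl2; rewrite /= !mxE.
Qed.

Lemma sl2_structured : structured_basis 3 sl2_const sl2_basis sl2_coord.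
Proof.
split.
- by case=> [|[|m]] a u v /=; rewrite !mxE.
- by case=> [|[|[|i]]] [|[|[|j]]] //= _ _; rewrite mxE.
- move=> x; rewrite !big_ord_recl big_ord0 addr0 /= sl2_comb.
  by rewrite {1}[x]sl2E; congr sl2; rewrite /= ?mulr1 ?mulr0 ?addr0 ?add0r.
- case=> [|[|[|i]]] [|[|[|j]]] //= _ _;
    rewrite lie_sl2 !big_ord_recl big_ord0 addr0 /= sl2_comb;
    by congr sl2; ring.
Qed.

End SL2.

Section Irreducible.
Variables (K : numClosedFieldType) (V : lieVectType (sl K 2)).
Implicit Types (x : sl K 2) (u v w : V).

Definition act_mx x : 'M[K]_(dim V) :=
  lin1_mx (fun r : 'rV_(dim V) => v2r (act x (r2v r : V))).

Lemma act_mxE x v : v2r v *m act_mx x = v2r (act x v).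
Proof.
have lin : linear (fun r : 'rV[K]_(dim V) => v2r (act x (r2v r : V))).
  by move=> a r s; rewrite linearP act_linear_r linearP.
pose g : {linear 'rV[K]_(dim V) -> 'rV[K]_(dim V)} :=
  HB.pack (fun r : 'rV[K]_(dim V) => v2r (act x (r2v r : V)))
    (GRing.isLinear.Build K _ _ *:%R _ lin).
by rewrite (mul_rV_lin1 g) /= v2rK.
Qed.

Lemma act_eigenvalue x v a :
  v != 0 -> act x v = a *: v -> eigenvalue (act_mx x) a.
Proof.
move=> v0 E; apply/eigenvalueP; exists (v2r v).
  by rewrite act_mxE E linearZ.
by apply: contra_neq v0 => v0; apply: (can_inj v2rK); rewrite v0 linear0.
Qed.

Lemma exists_eigenvector x : (0 < dim V)%N ->
  exists a v, v != 0 /\ act x v = a *: v.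
Proof.
move=> d0; have [a] : exists a, root (char_poly (act_mx x)) a.
  by apply/closed_rootP; rewrite size_char_poly eqSS -lt0n.
rewrite -eigenvalue_root_char => /eigenvalueP[r E r0].
exists a, (r2v r); split.
  by apply: contra_neq r0 => r0; rewrite -[r]r2vK r0 linear0.
by apply: (can_inj v2rK); rewrite -act_mxE r2vK E linearZ /= r2vK.
Qed.

(** Distinct eigenvalues are distinct roots of a characteristic polynomial. *)
Lemma eigenvalue_count x (v : nat -> V) (a : nat -> K) m :
    injective a -> (forall i, act x (v i) = a i *: v i) ->
    (forall i, (i <= m)%N -> v i != 0) ->
  (m < dim V)%N.
Proof.
move=> inj E nz; rewrite -[m.+1](size_iota 0) -(size_map a) -ltnS.
rewrite -(size_char_poly (act_mx x)); apply: max_poly_roots.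
- by rewrite -size_poly_gt0 size_char_poly.
- rewrite all_map; apply/allP=> i; rewrite mem_iota add0n ltnS => /= /nz vi.
  by rewrite -eigenvalue_root_char; apply: act_eigenvalue vi (E i).
- by rewrite map_inj_uniq ?iota_uniq.
Qed.

Local Notation e := (sl2_basis K 0).
Local Notation h := (sl2_basis K 1).
Local Notation f := (sl2_basis K 2).

Lemma lie_sl2_basis i j : (i < 3)%N -> (j < 3)%N ->
  lie (sl2_basis K i) (sl2_basis K j) =
  \sum_(m < 3) (sl2_const i j m)%:~R *: sl2_basis K m.
Proof. exact: (lie_basis (sl2_structured K)). Qed.

Lemma act_shift x (d a : K) v : lie h x = d *: x -> act h v = a *: v ->
  act h (act x v) = (a + d) *: act x v.
Proof.
move=> hx hv; have /eqP := act_lie h x v.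
by rewrite hx actZl hv actZr eq_sym subr_eq -scalerDl addrC => /eqP.
Qed.

Lemma act_iter x (d a : K) v i : lie h x = d *: x -> act h v = a *: v ->
  act h (iter i (act x) v) = (a + i%:R * d) *: iter i (act x) v.
Proof.
move=> hx hv; elim: i => [|i IH]; first by rewrite mul0r addr0.
by rewrite /= (act_shift hx IH) -addrA -natr1 mulrDl mul1r.
Qed.

(** An eigenvector x of ad h with nonzero eigenvalue shifts the eigenvalues of
    h, hence acts nilpotently in characteristic 0. *)
Lemma act_nilpotent x (d a : K) v :
    lie h x = d *: x -> d != 0 -> act h v = a *: v ->
  iter (dim V) (act x) v = 0.
Proof.
move=> hx d0 hv; apply/eqP/negP=> /negP nz.
suff : (dim V < dim V)%N by rewrite ltnn.
apply: (@eigenvalue_count h (fun i => iter i (act x) v)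
          (fun i => a + i%:R * d)).
- by move=> i j /addrI /(mulIf d0) /eqP; rewrite eqr_nat => /eqP.
- by move=> i; apply: act_iter.
move=> i le_i; apply: contra nz => /eqP z; rewrite -(subnK le_i) iterD z.
by elim: (_ - _)%N => //= n /eqP->; rewrite act0r.
Qed.

Lemma lie_he : lie h e = 2 *: e.
Proof.
by rewrite lie_sl2_basis // !big_ord_recl big_ord0 /= !scale0r !addr0.
Qed.

Lemma lie_hf : lie h f = - 2 *: f.
Proof.
by rewrite lie_sl2_basis // !big_ord_recl big_ord0 /= !scale0r addr0 !add0r.
Qed.

Lemma lie_ef : lie e f = h.
Proof.
rewrite lie_sl2_basis // !big_ord_recl big_ord0 /= !scale0r !addr0.
by rewrite add0r scale1r.
Qed.

Lemma exists_highest_weight : (0 < dim V)%N ->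
  exists (mu : K) w, [/\ w != 0, act e w = 0 & act h w = mu *: w].
Proof.
move=> d0; have [a [v [v0 hv]]] := exists_eigenvector h d0.
have two0 : 2 != 0 :> K by rewrite pnatr_eq0.
have ex : exists i, iter i (act e) v == 0.
  by exists (dim V); rewrite (act_nilpotent lie_he two0 hv).
have : iter (ex_minn ex) (act e) v = 0 by case: ex_minnP => i /eqP.
case: ex_minnP => [[|i]] /= z min z'; first by rewrite z' eqxx in v0.
exists (a + i%:R * 2), (iter i (act e) v); split=> //.
  by apply/negP=> /min; rewrite ltnn.
exact: act_iter lie_he hv.
Qed.

Lemma act_e_string (mu : K) w i : act e w = 0 -> act h w = mu *: w ->
  act e (iter i.+1 (act f) w) = (i.+1%:R * (mu - i%:R)) *: iter i (act f) w.
Proof.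
move=> ew hw.
have ef v : act e (act f v) = act h v + act f (act e v).
  by rewrite -lie_ef act_lie subrK.
elim: i => [|i IH]; first by rewrite /= ef ew act0r hw addr0 subr0 mul1r.
rewrite iterS ef IH actZr -iterS (act_iter _ lie_hf hw) -scalerDl.
by congr (_ *: _); rewrite -!natr1; ring.
Qed.

Lemma act_sl2 x v : act x v = sl2_coord 0 x *: act e v
  + (sl2_coord 1 x *: act h v + sl2_coord 2 x *: act f v).
Proof.
rewrite {1}[x](basis_expand (sl2_structured K)) !big_ord_recl big_ord0 addr0.
by rewrite !act_linear_l !actZl.
Qed.

Hypothesis V_irr : irreducible_module V.
Hypothesis V_dim : \dim {:V} = 3.

(** The span of the f-string of a highest weight vector w is stable, so it is
    the whole module and the string has length exactly 3. *)
Lemma weight_basis : exists u0 u1 u2 : V,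
  [/\ basis_of fullv [tuple u0; u1; u2],
      [/\ act e u0 = 0, act e u1 = 2 *: u0 & act e u2 = 2 *: u1],
      [/\ act h u0 = 2 *: u0, act h u1 = 0 & act h u2 = - 2 *: u2] &
      [/\ act f u0 = u1, act f u1 = u2 & act f u2 = 0]].
Proof.
have dV : dim V = 3 by rewrite -V_dim dimvf.
have [mu [w [w0 ew hw]]] : exists (mu : K) w,
    [/\ w != 0, act e w = 0 & act h w = mu *: w].
  by apply: exists_highest_weight; rewrite dV.
pose y i := iter i (act f) w.
have two0 : - 2 != 0 :> K by rewrite oppr_eq0 pnatr_eq0.
have y3 : y 3 = 0 by have := act_nilpotent lie_hf two0 hw; rewrite dV.
have hy i : act h (y i) = (mu + i%:R * - 2) *: y i := act_iter i lie_hf hw.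
have ey i : act e (y i.+1) = (i.+1%:R * (mu - i%:R)) *: y i.
  exact: act_e_string ew hw.
pose U := <<[:: y 0%N; y 1%N; y 2%N]>>%VS.
have yU i : (i < 3)%N -> y i \in U.
  by case: i => [|[|[|i]]] // _; apply: memv_span; rewrite !inE eqxx ?orbT.
have Ufull : U = fullv.
  case: (V_irr) => _ /(_ U) [x v Uv||//]; last first.
    by move=> U0; have := yU 0 isT; rewrite U0 memv0 (negbTE w0).
  have stable g : (forall i, (i < 3)%N -> act g (y i) \in U) -> act g v \in U.
    move=> gU; rewrite (coord_span Uv) !big_ord_recl big_ord0 addr0 /=.
    by rewrite !actDr !actZr !memvD // memvZ // ?(gU 0) ?(gU 1) ?(gU 2).
  rewrite act_sl2 !memvD // memvZ // stable // => i i3.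
  - case: i i3 => [|i] i3; first by rewrite (_ : y 0%N = w) // ew mem0v.
    by rewrite ey memvZ // yU // ltnW.
  - by rewrite hy memvZ ?yU.
  - case: (ltnP i 2) => i2; first exact: (yU i.+1).
    have -> : i = 2%N by apply/eqP; rewrite eqn_leq i2 -ltnS i3.
    by rewrite [act f _]y3 mem0v.
have basis_y : basis_of fullv [tuple y 0; y 1; y 2].
  by rewrite basisEdim V_dim andbT -[<<_>>%VS]/U Ufull subvv.
have y2 : y 2 != 0.
  have /andP[_ /free_not0] := basis_y; apply.
  by rewrite !inE eqxx !orbT.
have mu2 : mu = 2.
  apply/eqP; rewrite -subr_eq0; have /eqP := ey 2; rewrite y3 act0r eq_sym.
  by rewrite scaler_eq0 (negbTE y2) orbF mulf_eq0 pnatr_eq0.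
exists (y 0%N), (y 1%N), (y 2%N); split=> //.
- by split; rewrite ?ey ?mu2 //; congr (_ *: _); ring.
- by split; rewrite hy mu2; [| rewrite -[RHS](scale0r (y 1%N)) |];
    congr (_ *: _); ring.
Qed.

(** Rescaling the weight basis by 1, -1, -1/2 turns it into a copy of e, h, f:
    indeed [f, e] = - h and [f, [f, e]] = - 2 f. *)
Lemma adjoint_basis : exists X : 3.-tuple V, basis_of fullv X /\
  forall i j, (i < 3)%N -> (j < 3)%N -> act (sl2_basis K i) (nth 0 X j) =
    \sum_(m < 3) (sl2_const i j m)%:~R *: nth 0 X m.
Proof.
have [u0 [u1 [u2 [Xb [e0 e1 e2] [h0 h1 h2] [f0 f1 f2]]]]] := weight_basis.
have two : 2 != 0 :> K by rewrite pnatr_eq0.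
exists [tuple u0; - u1; - 2^-1 *: u2]; split.
  rewrite basisEdim V_dim andbT -(span_basis Xb).
  apply/span_subvP=> u; rewrite !inE => /or3P[] /eqP->.
  - by apply: memv_span; rewrite inE eqxx.
  - by rewrite -memvN memv_span // !inE eqxx orbT.
  - suff : - 2 *: (- 2^-1 *: u2) \in <<[:: u0; - u1; - 2^-1 *: u2]>>%VS.
      by rewrite scalerA mulrNN mulfV // scale1r.
    by rewrite memvZ // memv_span // !inE eqxx !orbT.
move: e0 e1 e2 h0 h1 h2 f0 f1 f2; rewrite /= => e0 e1 e2 h0 h1 h2 f0 f1 f2.
case=> [|[|[|i]]] [|[|[|j]]] //= _ _; rewrite !big_ord_recl big_ord0 /=;
  rewrite ?actNr ?actZr ?e0 ?e1 ?e2 ?h0 ?h1 ?h2 ?f0 ?f1 ?f2;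
  rewrite ?scaler0 ?oppr0 ?scale0r ?addr0 ?add0r ?scale0r ?addr0 ?add0r //.
- by rewrite -scaleNr.
- by rewrite scalerA mulNr mulVf // scaleN1r scale1r.
- by rewrite !scalerA mulrC.
- by rewrite [RHS]scaleN1r opprK.
- by rewrite scalerA mulrN mulfV // scaleN1r.
Qed.

End Irreducible.

(** * The Takiff algebra of a Lie algebra *)

(** Index i = n q + r stands for t^q times the r-th basis vector of L; a bracket
    is nonzero only if the exponents of t add up to at most 1. *)
Definition takiff_const (n : nat) (c : nat -> nat -> nat -> int)
    (i j m : nat) : int :=
  if (i %/ n + j %/ n == m %/ n)%N then c (i %% n)%N (j %% n)%N (m %% n)%N
  else 0%Z.

(** The module M is assumed to have a basis on which L acts with its own
    structure constants, that is, to be a copy of the adjoint module. *)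
Section Takiff.
Variables (F : fieldType) (L : lieAlgType F) (M : lieModType L) (n : nat).
Variables (c : nat -> nat -> nat -> int) (s : nat -> L) (sco : nat -> L -> F).
Variables (v : nat -> M) (vco : nat -> M -> F).
Hypothesis S : structured_basis n c s sco.
Hypothesis vco_linear : forall m (a : F) u w,
  vco m (a *: u + w) = a * vco m u + vco m w.
Hypothesis vco_basis : forall i j, (i < n)%N -> (j < n)%N ->
  vco i (v j) = (i == j)%:R.
Hypothesis v_expand : forall u, u = \sum_(m < n) vco m u *: v m.
Hypothesis act_basis : forall i j, (i < n)%N -> (j < n)%N ->
  act (s i) (v j) = \sum_(m < n) (c i j m)%:~R *: v m.
Local Notation g := (semidirect M).

Definition takiff_basis (m : nat) : g :=
  if (m < n)%N then (s m, 0) else (0, v (m - n)).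

Definition takiff_coord (m : nat) (x : g) : F :=
  if (m < n)%N then sco m x.1 else vco (m - n) x.2.

Lemma takiff_sum (a : nat -> F) :
  \sum_(m < n + n) a m *: takiff_basis m =
  (\sum_(m < n) a m *: s m, \sum_(m < n) a (n + m)%N *: v m) :> g.
Proof.
have sum_pair (r : seq 'I_n) (E : 'I_n -> L) (G : 'I_n -> M) :
    \sum_(i <- r) ((E i, G i) : g) = (\sum_(i <- r) E i, \sum_(i <- r) G i).
  by elim: r => [|i r IH]; rewrite ?big_nil // !big_cons IH.
rewrite big_split_ord /=.
rewrite (eq_bigr (fun i : 'I_n => (a i *: s i, 0) : g)) => [|i _]; last first.
  by rewrite /takiff_basis ltn_ord; congr pair; exact: scaler0.
rewrite [X in _ + X](eq_bigr (fun i : 'I_n => (0, a (n + i)%N *: v i) : g)).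
  by rewrite !sum_pair !big1_eq; congr pair; rewrite ?addr0 ?add0r.
move=> i _; rewrite /takiff_basis ltnNge leq_addr addKn; congr pair.
exact: scaler0.
Qed.

Lemma vco0 m : vco m 0 = 0.
Proof.
by have := vco_linear m (-1) 0 0; rewrite scaleN1r oppr0 addr0 mulN1r addNr.
Qed.

Lemma const_anticomm i j m : (i < n)%N -> (j < n)%N -> (m < n)%N ->
  (c j i m)%:~R = - (c i j m)%:~R :> F.
Proof.
move=> ltin ltjn ltmn.
rewrite -(basis_coord_expand S (fun q => (c j i q)%:~R) ltmn).
rewrite -(basis_coord_expand S (fun q => (c i j q)%:~R) ltmn).
by rewrite -!(lie_basis S) // lie_anticomm (basis_coordN S).
Qed.

Lemma takiff_structured :
  structured_basis (n + n) (takiff_const n c) takiff_basis takiff_coord.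
Proof.
split.
- move=> m a u w; rewrite /takiff_coord; case: ifP => _ /=.
    exact: (basis_coord_linear S).
  exact: vco_linear.
- move=> i j lt_i lt_j; rewrite /takiff_coord /takiff_basis.
  case: (ltnP i n) (ltnP j n) => [lt_in|le_ni] [lt_jn|le_nj] /=.
  + exact: (basis_coordE S).
  + by rewrite (basis_coord0 S) (ltn_eqF (leq_trans lt_in le_nj)).
  + by rewrite vco0 (gtn_eqF (leq_trans lt_jn le_ni)).
  + rewrite vco_basis ?ltn_subLR // -(eqn_add2r n) !subnK //.
- move=> x; rewrite (takiff_sum (fun m => takiff_coord m x)).
  case: x => x u; congr pair.
    rewrite {1}[x](basis_expand S); apply: eq_bigr => m _.
    by rewrite /takiff_coord ltn_ord.
  rewrite {1}[u]v_expand; apply: eq_bigr => m _.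
  by rewrite /takiff_coord ltnNge leq_addr addKn.
- move=> i j lt_i lt_j.
  rewrite (takiff_sum (fun m => (takiff_const n c i j m)%:~R)) /takiff_basis.
  have div_lo m : (m < n)%N -> ((m %/ n)%N = 0%N) * ((m %% n)%N = m).
    by move=> lt_m; rewrite divn_small ?modn_small.
  have div_hi m : (m < n)%N ->
      (((n + m) %/ n)%N = 1%N) * (((n + m) %% n)%N = m).
    move=> lt_m; have n0 : (0 < n)%N by case: (n) lt_m.
    by rewrite divnDl // divnn n0 divn_small // modnDl modn_small.
  have sum0 (T : lmodType F) (a : 'I_n -> int) (w : 'I_n -> T) :
      (forall m, a m = 0) -> 0 = \sum_(m < n) (a m)%:~R *: w m.
    by move=> a0; rewrite big1 // => m _; rewrite a0 scale0r.
  have hi m : (m < n + n)%N -> (n <= m)%N ->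
      exists2 m', m = (n + m')%N & (m' < n)%N.
    by move=> lt_m le_m; exists (m - n)%N; rewrite ?subnKC // ltn_subLR.
  case: (ltnP i n) => [lt_in|/(hi _ lt_i)[i' -> lt_i']];
  case: (ltnP j n) => [lt_jn|/(hi _ lt_j)[j' -> lt_j']];
    rewrite ?addKn; congr pair => /=.
  + rewrite (lie_basis S) //; apply: eq_bigr => m _.
    by rewrite /takiff_const !div_lo.
  + rewrite !act0r subrr; apply: sum0 => m.
    by rewrite /takiff_const !div_hi // !div_lo.
  + rewrite lie0r; apply: sum0 => m.
    by rewrite /takiff_const !div_hi // !div_lo.
  + rewrite act0r subr0 act_basis //; apply: eq_bigr => m _.
    by rewrite /takiff_const !div_hi // !div_lo.
  + rewrite lie0l; apply: sum0 => m.
    by rewrite /takiff_const !div_hi // !div_lo.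
  + rewrite act0r sub0r act_basis // -sumrN; apply: eq_bigr => m _.
    rewrite /takiff_const !div_hi // !div_lo //.
    by rewrite (const_anticomm lt_i' lt_jn (ltn_ord m)) scaleNr opprK.
  + rewrite lie0l; apply: sum0 => m.
    by rewrite /takiff_const !div_hi // !div_lo.
  + rewrite !act0l subrr; apply: sum0 => m.
    by rewrite /takiff_const !div_hi.
Qed.

End Takiff.

(** * The homotopy for the Takiff algebra of sl2 *)

Definition weight (m : nat) : int :=
  match (m %% 3)%N with 0 => 1%Z | 2 => (-1)%Z | _ => 0%Z end%N.

(** Half the eigenvalue of the Lie derivative L_h on the coordinate. *)
Definition cochain_weight (i : cochain_index) : int :=
  weight i.2 - foldr (fun a w => weight a + w) 0%Z i.1.

Definition term (a : int) (s : seq nat) (m : nat) : int * cochain_index :=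
  (a, (s, m)).
Arguments term a%_Z s%_N m%_N.

(** The nonzero rows of the homotopy in weight 0, where the complex has
    dimensions 2, 12, 26, 32, 26, 12, 2.  In each degree k choose a maximal set
    A_k of coordinates on whose span d is injective, and as many coordinates
    R_(k+1), outside A_(k+1), that detect the image of this span; the table is
    12 times the inverse of the submatrix of d with columns A_k and rows
    R_(k+1).  This h satisfies h h = 0 and h d h = 12 h, hence 12 - d h - h d is
    a multiple of a projection onto a copy of the cohomology, which has
    dimension at most 1 in each degree. *)
Definition homotopy_table : seq (seq nat * nat * int_form) := ([::
  ([::], 1, [:: term (-6) [:: 0] 0]);
  ([::], 4, [:: term 6 [:: 2] 5]);
  ([:: 0], 3, [:: term 12 [:: 0; 2] 4; term (-6) [:: 1; 2] 5]);
  ([:: 1], 1, [:: term (-6) [:: 1; 2] 2]);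
  ([:: 1], 4, [:: term (-6) [:: 1; 2] 5]);
  ([:: 2], 2, [:: term (-6) [:: 0; 4] 3; term (-12) [:: 2; 3] 4]);
  ([:: 3], 0, [:: term (-6) [:: 2; 3] 1; term (-3) [:: 3; 4] 3]);
  ([:: 3], 3, [:: term 6 [:: 0; 4] 3]);
  ([:: 4], 1, [:: term 6 [:: 2; 3] 1; term (-3) [:: 3; 4] 3]);
  ([:: 5], 2, [:: term 12 [:: 0; 5] 1; term 6 [:: 2; 3] 1;
     term (-3) [:: 3; 4] 3]);
  ([:: 5], 5, [:: term 12 [:: 0; 5] 4]);
  ([:: 0; 1], 0, [:: term (-12) [:: 0; 1; 2] 1]);
  ([:: 0; 1], 3, [:: term (-12) [:: 0; 1; 2] 4]);
  ([:: 0; 2], 1, [:: term (-4) [:: 0; 2; 3] 3; term 2 [:: 0; 2; 4] 4;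
     term 2 [:: 0; 2; 5] 5; term (-4) [:: 1; 2; 3] 4; term 1 [:: 1; 2; 4] 5]);
  ([:: 0; 4], 0, [:: term (-12) [:: 0; 4; 5] 4; term 12 [:: 2; 3; 5] 5]);
  ([:: 1; 3], 0, [:: term (-12) [:: 0; 2; 3] 0; term 12 [:: 0; 4; 5] 4;
     term (-12) [:: 2; 3; 5] 5]);
  ([:: 1; 3], 3, [:: term (-4) [:: 0; 2; 3] 3; term (-4) [:: 0; 2; 4] 4;
     term (-4) [:: 0; 2; 5] 5; term 8 [:: 1; 2; 3] 4;
     term (-2) [:: 1; 2; 4] 5]);
  ([:: 1; 4], 1, [:: term (-12) [:: 0; 2; 4] 1; term 12 [:: 0; 3; 5] 3;
     term (-12) [:: 0; 4; 5] 4; term (-12) [:: 2; 3; 4] 4;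
     term 12 [:: 2; 3; 5] 5]);
  ([:: 1; 4], 4, [:: term (-4) [:: 0; 2; 3] 3; term (-4) [:: 0; 2; 4] 4;
     term (-4) [:: 0; 2; 5] 5; term (-4) [:: 1; 2; 3] 4;
     term (-2) [:: 1; 2; 4] 5]);
  ([:: 1; 5], 2, [:: term (-12) [:: 0; 2; 5] 2; term (-12) [:: 0; 3; 5] 3;
     term 12 [:: 2; 3; 4] 4]);
  ([:: 1; 5], 5, [:: term (-4) [:: 0; 2; 3] 3; term (-4) [:: 0; 2; 4] 4;
     term (-4) [:: 0; 2; 5] 5; term (-4) [:: 1; 2; 3] 4;
     term 4 [:: 1; 2; 4] 5]);
  ([:: 2; 4], 2, [:: term 12 [:: 0; 3; 5] 3; term (-12) [:: 2; 3; 4] 4]);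
  ([:: 2; 4], 5, [:: term (-4) [:: 0; 2; 3] 3; term 8 [:: 0; 2; 4] 4;
     term (-4) [:: 0; 2; 5] 5; term (-4) [:: 1; 2; 3] 4;
     term (-2) [:: 1; 2; 4] 5]);
  ([:: 3; 4], 0, [:: term (-12) [:: 2; 3; 4] 1]);
  ([:: 3; 5], 4, [:: term (-6) [:: 0; 3; 5] 3]);
  ([:: 4; 5], 2, [:: term 12 [:: 2; 3; 5] 2]);
  ([:: 4; 5], 5, [:: term 12 [:: 0; 3; 5] 3; term 12 [:: 2; 3; 5] 5]);
  ([:: 0; 1; 4], 0, [:: term 12 [:: 0; 1; 4; 5] 4; term 24 [:: 0; 2; 3; 5] 4;
     term 12 [:: 0; 2; 4; 5] 5]);
  ([:: 0; 1; 4], 3, [:: term 12 [:: 0; 1; 2; 3] 3]);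
  ([:: 0; 1; 5], 1, [:: term (-6) [:: 0; 1; 3; 5] 3; term 6 [:: 0; 2; 3; 4] 3;
     term 12 [:: 0; 2; 3; 5] 4]);
  ([:: 0; 1; 5], 4, [:: term 6 [:: 0; 1; 2; 5] 5]);
  ([:: 0; 3; 5], 0, [:: term 2 [:: 0; 1; 4; 5] 1; term 4 [:: 0; 2; 3; 4] 0;
     term 4 [:: 0; 2; 3; 5] 1; term (-2) [:: 0; 2; 4; 5] 2;
     term 4 [:: 1; 3; 4; 5] 4]);
  ([:: 0; 4; 5], 1, [:: term (-2) [:: 0; 1; 4; 5] 1; term 2 [:: 0; 2; 3; 4] 0;
     term (-4) [:: 0; 2; 3; 5] 1; term (-4) [:: 0; 2; 4; 5] 2;
     term 2 [:: 1; 3; 4; 5] 4]);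
  ([:: 1; 2; 3], 1, [:: term 12 [:: 0; 2; 3; 5] 4; term 6 [:: 0; 2; 4; 5] 5;
     term (-6) [:: 1; 2; 3; 5] 5]);
  ([:: 1; 2; 4], 2, [:: term 12 [:: 0; 1; 2; 4] 1;
     term (-12) [:: 0; 1; 3; 5] 3; term 12 [:: 0; 1; 4; 5] 4;
     term 12 [:: 0; 2; 3; 4] 3; term 24 [:: 0; 2; 3; 5] 4;
     term 12 [:: 1; 2; 3; 5] 5]);
  ([:: 1; 3; 4], 0, [:: term 4 [:: 0; 1; 4; 5] 1; term (-4) [:: 0; 2; 3; 4] 0;
     term 8 [:: 0; 2; 3; 5] 1; term (-4) [:: 0; 2; 4; 5] 2;
     term 8 [:: 1; 3; 4; 5] 4]);
  ([:: 1; 3; 4], 3, [:: term (-12) [:: 0; 2; 3; 4] 3]);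
  ([:: 1; 3; 5], 1, [:: term 4 [:: 0; 1; 4; 5] 1; term 2 [:: 0; 2; 3; 4] 0;
     term (-4) [:: 0; 2; 3; 5] 1; term 2 [:: 0; 2; 4; 5] 2;
     term 2 [:: 1; 3; 4; 5] 4]);
  ([:: 1; 3; 5], 4, [:: term (-12) [:: 0; 2; 3; 5] 4]);
  ([:: 1; 4; 5], 2, [:: term 4 [:: 0; 1; 4; 5] 1; term (-4) [:: 0; 2; 3; 4] 0;
     term 8 [:: 0; 2; 3; 5] 1; term (-4) [:: 0; 2; 4; 5] 2;
     term (-4) [:: 1; 3; 4; 5] 4]);
  ([:: 1; 4; 5], 5, [:: term (-12) [:: 0; 2; 4; 5] 5]);
  ([:: 3; 4; 5], 1, [:: term 6 [:: 2; 3; 4; 5] 2]);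
  ([:: 3; 4; 5], 4, [:: term 6 [:: 2; 3; 4; 5] 5]);
  ([:: 0; 1; 2; 3], 0, [:: term 3 [:: 0; 1; 2; 3; 4] 3;
     term (-6) [:: 0; 1; 2; 3; 5] 4; term (-3) [:: 0; 1; 2; 4; 5] 5]);
  ([:: 0; 1; 2; 5], 2, [:: term 6 [:: 0; 1; 2; 4; 5] 5]);
  ([:: 0; 1; 3; 5], 0, [:: term (-6) [:: 0; 1; 3; 4; 5] 3]);
  ([:: 0; 3; 4; 5], 0, [:: term (-6) [:: 0; 1; 3; 4; 5] 0;
     term 12 [:: 0; 2; 3; 4; 5] 1]);
  ([:: 0; 3; 4; 5], 3, [:: term 12 [:: 0; 2; 3; 4; 5] 4]);
  ([:: 1; 2; 3; 4], 1, [:: term (-6) [:: 0; 1; 2; 3; 4] 0;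
     term 6 [:: 0; 1; 3; 4; 5] 3]);
  ([:: 1; 2; 3; 4], 4, [:: term (-3) [:: 0; 1; 2; 3; 4] 3;
     term (-6) [:: 0; 1; 2; 3; 5] 4; term (-3) [:: 0; 1; 2; 4; 5] 5]);
  ([:: 1; 2; 3; 5], 2, [:: term 6 [:: 0; 1; 2; 4; 5] 2]);
  ([:: 1; 3; 4; 5], 1, [:: term (-6) [:: 0; 1; 3; 4; 5] 0]);
  ([:: 1; 2; 3; 4; 5], 2, [:: term 12 [:: 0; 1; 2; 3; 4; 5] 1]);
  ([:: 1; 2; 3; 4; 5], 5, [:: term 12 [:: 0; 1; 2; 3; 4; 5] 4])
])%N.

(** Away from weight 0, contraction with h (index 1) is a homotopy from 0 to
    L_h, which is multiplication by 2 w on weight w; dividing by it and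
    multiplying by 12 gives the factor 6 / w, an integer as |w| <= 3. *)
Definition homotopy_form (i : cochain_index) : int_form :=
  match cochain_weight i with
  | 0%Z =>
    let r := [seq p <- homotopy_table | p.1 == i] in
    if r is p :: _ then p.2 else [::]
  | w => scalef (6 %/ w)%Z (key_form (1%N :: i.1) i.2)
  end.

(** 12 times, in degree 1, the H-coordinate of f(H); in degree 2, the
    h-coordinate of f(E, F); in degree 4, the trace over V2 of
    x |-> f(e, h, f, x); in degree 5, the trace of f(e, h, f, -, -) composed
    with the inverse of the isomorphism from the exterior square of V2 to sl2
    that maps E /\ H, E /\ F, H /\ F to - 2 e, h, - 2 f. *)
Definition class_form (k : nat) : int_form :=
  match k with
  | 1 => [:: term 12 [:: 4] 4]
  | 2 => [:: term 12 [:: 3; 5] 1]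
  | 4 => [:: term 12 [:: 0; 1; 2; 3] 3; term 12 [:: 0; 1; 2; 4] 4;
            term 12 [:: 0; 1; 2; 5] 5]
  | 5 => [:: term 12 [:: 0; 1; 2; 3; 5] 1; term (-6) [:: 0; 1; 2; 3; 4] 0;
            term (-6) [:: 0; 1; 2; 4; 5] 2]
  | _ => [::]
  end%N.

(** In degree 1, the derivation that is 1 on V2 and 0 on sl2; in degree 2, the
    bracket V2 x V2 -> sl2; in degrees 4 and 5, one component of the exterior
    product of these two with the volume form of sl2.  As sl2 acts trivially on
    cohomology, such a component has the class of its projection on the
    invariants, which is a nonzero multiple of that exterior product. *)
Definition class_cocycle (k : nat) : int_form :=
  match k with
  | 1 => [:: term 1 [:: 3] 3; term 1 [:: 4] 4; term 1 [:: 5] 5]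
  | 2 => [:: term (-2) [:: 3; 4] 0; term 1 [:: 3; 5] 1; term (-2) [:: 4; 5] 2]
  | 4 => [:: term 1 [:: 0; 1; 2; 4] 4]
  | 5 => [:: term 1 [:: 0; 1; 2; 3; 5] 1]
  | _ => [::]
  end%N.

Lemma class_nil k : k \notin [:: 1; 2; 4; 5]%N ->
  class_cocycle k = [::] /\ class_form k = [::].
Proof. by case: k => [|[|[|[|[|[|k]]]]]]. Qed.

(** There is no increasing list of more than n indices below n, so the complex
    vanishes in degrees above n. *)
Lemma indices_large n k : (n < k)%N -> indices n k = [::].
Proof.
move=> lt_nk; rewrite /indices (_ : [seq s <- _ | _] = [::]) //.
apply/eqP; rewrite -size_eq0 size_filter -leqn0 leqNgt -has_count.
apply/hasPn=> s; rewrite mem_subseqs => /size_subseq; rewrite size_iota => le_n.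
by rewrite ltn_eqF // (leq_ltn_trans le_n).
Qed.

Lemma takiff_homotopy k :
  homotopy_check 6 (takiff_const 3 sl2_const) 12 homotopy_form k
    (class_cocycle k) (class_form k).
Proof.
case: (ltnP 6 k) => [lt_k|]; first by rewrite /homotopy_check indices_large.
by do 7?[case: k => [_|k]; first by vm_compute].
Qed.

Lemma takiff_class k : k \in [:: 1; 2; 4; 5]%N ->
  class_check 6 (takiff_const 3 sl2_const) 12 k
    (class_cocycle k) (class_form k).
Proof. by rewrite !inE => /or4P[] /eqP->; vm_compute. Qed.

Theorem cohomology_takiff (K : numClosedFieldType) (V : lieVectType (sl K 2))
    (V_irr : irreducible_module V) (V_dim : \dim {:V} = 3) (k : nat) :
  let H := cohomology (adjoint (semidirect V)) in
  if k \in [:: 1; 2; 4; 5]%N then lmod_iso (H k) K^o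
  else forall x : H k, x = 0.
Proof.
have [X [Xb actX]] := adjoint_basis V_irr V_dim.
pose vco (m : nat) (u : V) : K := coord X (inord m) u.
have vco_linear m (a : K) (u w : V) :
    vco m (a *: u + w) = a * vco m u + vco m w.
  exact: linearP.
have vco_basis i j : (i < 3)%N -> (j < 3)%N -> vco i (nth 0 X j) = (i == j)%:R.
  move=> lt_i lt_j; rewrite /vco (coord_free (Ordinal lt_j) (inord i)).
    by rewrite eq_sym -val_eqE /= inordK.
  exact: basis_free Xb.
have v_expand (u : V) : u = \sum_(m < 3) vco m u *: nth 0 X m.
  rewrite {1}(coord_basis Xb (memvf u)); apply: eq_bigr => m _.
  by rewrite /vco inord_val.
have B :=
  takiff_structured (sl2_structured K) vco_linear vco_basis v_expand actX.
have N0 : 12%Z%:~R != 0 :> K by rewrite intr_eq0.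
have hom := takiff_homotopy k; rewrite /=; case: ifP => [k_in|/negbT k_out].
  have := takiff_class k_in; case: k hom k_in => // k hom _ cls.
  exact: (cohomology_line B N0 hom cls).
have [z0 ell0] := class_nil k_out; rewrite z0 ell0 in hom.
exact: (cohomology_eq0 B N0 hom).
Qed.

Local Close Scope ring_scope.

Theorem proposition4p2 (R : realType) (V2 : lieVectType (sl R[i] 2))
    (V2_irr : irreducible_module V2) (V2_dim : \dim {:V2} = 3) (k : nat) :
  let g := semidirect V2 in
  let H := cohomology (adjoint g) in
  if k \in [:: 1; 2; 4; 5]
  then lmod_iso (H k) (R[i]^o)%R
  else forall x : H k, x = 0%R.
Proof. exact: (cohomology_takiff V2_irr V2_dim k). Qed.
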